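(* Fix $0<\lambda<1/2$. For every integer $r\ge 1$ and every $0<\alpha\le 1$, setting $s=r+\alpha$, there exists a $C^{s}([0,1])$ diffeomorphism $g$ such that: 1. the push-forward $g\mu_\lambda$ is a self-conformal measure; 2. there exists $\eta>0$ such that $g'\equiv\eta$ on $\operatorname{supp}(\mu_\lambda)$; 3. there exist $\tau=\tau(s,\lambda)>0$ and a constant $C>0$ such that $|\widehat{g\mu_\lambda}(\xi)|\le C|\xi|^{-\tau}$ for all $\xi\neq 0$; one may take $$\tau(s,\lambda)=\frac{2\pi\,\lambda^{2s}}{(18e+\pi)\,s\log(1/\lambda)}>0 .$$ This is true even if $\lambda^{-1}$ is a Pisot number and therefore $\mu_\lambda$ itself is not Rajchman.
   Context: For $0<\lambda<1/2$, $\mu_\lambda$ is the Bernoulli convolution on $[0,1]$: the unique Borel probability measure with $\mu_\lambda=\frac12 (e_0)_*\mu_\lambda+\frac12 (e_1)_*\mu_\lambda$, where $e_0(x)=\lambda x$ and $e_1(x)=\lambda x+1-\lambda$. $C^{s}$ with $s=r+\alpha$ ($r\geq 1$ an integer, $0<\alpha\le1$) means $C^{r,\alpha}$: $r$ times continuously differentiable with $\alpha$-Hölder $r$-th derivative. A $C^s([0,1])$ diffeomorphism is a $C^s$ diffeomorphism $g:[0,1]\to[0,1]$. A Borel probability measure $\mu$ on $[0,1]$ is self-conformal if there are finitely many maps $f_1,\dots,f_n:[0,1]\to[0,1]$, $f_i\in C^1([0,1])$, $|f_i'|\in(0,1)$ on $[0,1]$, not all sharing the same fixed point, and a strictly positive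 probability vector $(p_1,\dots,p_n)$ with $\mu=\sum_{i=1}^n p_i\cdot (f_i)_*\mu$. The Fourier transform is $\widehat\mu(\xi)=\int e^{-2\pi i\xi t}\,d\mu(t)$; $\mu$ is Rajchman if $\widehat\mu(\xi)\to0$ as $|\xi|\to\infty$. A Pisot number is a real algebraic integer greater than $1$ all of whose other Galois conjugates have modulus less than $1$. *)

(* Defs.v *)
From HB Require Import structures.
From mathcomp Require Import all_boot all_order all_algebra.
From mathcomp Require Import complex.
From mathcomp Require Import all_classical all_reals all_analysis.

Set Implicit Arguments.
Unset Strict Implicit.
Unset Printing Implicit Defensive.

Import Order.TTheory GRing.Theory Num.Theory.
Import numFieldNormedType.Exports.

Local Open Scope classical_set_scope.
Local Open Scope ring_scope.

(* A map of [0,1] is represented by a total function R -> R of which only the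
   values on [0,1] matter. *)
Section calculus_on_unit_interval.
Context {R : realType}.
Implicit Types (f g h : R -> R).

Definition I01 : set R := `[0, 1].

(* The limit runs over y in [0,1], y != x, so derivatives are one-sided at the
   endpoints 0 and 1. *)
Definition diff_quotient01 f (x : R) :=
  (f y - f x) / (y - x) @[y --> within I01 x^'].

Definition derivable01 f (x : R) := cvg (diff_quotient01 f x).

Definition deriv01 f (x : R) : R := lim (diff_quotient01 f x).

Definition deriv01n (k : nat) f : R -> R := iter k deriv01 f.

Definition Cr01 (r : nat) f :=
  (forall k, (k < r)%N -> {in I01, forall x, derivable01 (deriv01n k f) x}) /\
  (forall k, (k <= r)%N -> {within I01, continuous (deriv01n k f)}).

Definition holder01 (alpha : R) f :=
  exists K : R, {in I01 &, forall x y, `|f x - f y| <= K * `|x - y| `^ alpha}.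

Definition Cralpha01 (r : nat) (alpha : R) f :=
  Cr01 r f /\ holder01 alpha (deriv01n r f).

Definition diffeo01 (r : nat) (alpha : R) g :=
  [/\ set_bij I01 I01 g, Cralpha01 r alpha g &
      exists h, [/\ {homo h : x / I01 x},
                    {in I01, cancel g h}, {in I01, cancel h g} &
                    Cralpha01 r alpha h]].

End calculus_on_unit_interval.

Notation normc := ComplexField.Normc.normc.

Section measures_on_the_line.
Context {R : realType}.
Local Notation borelR := (measurableTypeR R).
Implicit Types (mu : probability borelR R).

(* Borel probability measures on [0,1] are Borel probability measures on the
   line giving full mass to [0,1]. *)
Definition on_unit_interval mu := mu I01 = 1%E.

Definition topological_support mu : set R :=
  [set x | forall U : set R, open U -> U x -> (0 < mu U)%E].

(* fourier mu xi is the integral of exp(- 2 pi i xi t), split into its real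
   part cos(2 pi xi t) and its imaginary part - sin(2 pi xi t). *)
Definition fourier mu (xi : R) : R[i] :=
  Complex (\int[mu]_t cos (2 * pi * xi * t))%R
          (- (\int[mu]_t sin (2 * pi * xi * t))%R).

Definition rajchman mu :=
  (normc (fourier mu xi) @[xi --> +oo] --> (0 : R)) /\
  (normc (fourier mu xi) @[xi --> -oo] --> (0 : R)).

Definition e0 (lambda : R) : borelR -> borelR := fun x => lambda * x.

Definition e1 (lambda : R) : borelR -> borelR :=
  fun x => lambda * x + 1 - lambda.

Definition bernoulli_convolution (lambda : R) mu :=
  on_unit_interval mu /\
  forall A : set borelR, measurable A ->
    mu A = ((2^-1)%:E * pushforward mu (e0 lambda) A
          + (2^-1)%:E * pushforward mu (e1 lambda) A)%E.

Definition self_conformal mu :=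
  on_unit_interval mu /\
  exists (n : nat) (f : 'I_n -> {mfun borelR >-> borelR}) (p : 'I_n -> R),
  [/\ forall i, [/\ {homo f i : x / I01 x}, Cr01 1 (f i) &
                    {in I01, forall x, 0 < `|deriv01 (f i) x| < 1}],
      ~ (exists2 x, I01 x & forall i, f i x = x),
      (forall i, 0 < p i) /\ \sum_(i < n) p i = 1 &
      forall A : set borelR, measurable A ->
        mu A = (\sum_(i < n) (p i)%:E * pushforward mu (f i) A)%E].

End measures_on_the_line.

(* The Galois conjugates of x are the complex roots of the irreducible monic
   integer polynomial p vanishing at x. *)
Definition pisot (R : realType) (x : R) :=
  1 < x /\
  exists p : {poly int},
    [/\ p \is monic, irreducible_poly (map_poly intr p : {poly rat}),
        root (map_poly intr p) x &
        forall z : R[i], root (map_poly intr p) z -> z != real_complex R x ->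
          normc z < 1].

Definition decay_exponent (R : realType) (s lambda : R) : R :=
  2 * pi * lambda `^ (2 * s) / ((18 * expR 1 + pi) * s * ln lambda^-1).

(* Main.v *)
Require Import Defs.
From HB Require Import structures.
From mathcomp Require Import all_boot all_order all_algebra.
From mathcomp Require Import all_field complex.
From mathcomp Require Import all_classical all_reals all_analysis measurable_realfun.
From mathcomp Require Import ring lra zify.

Set Implicit Arguments.
Unset Strict Implicit.
Unset Printing Implicit Defensive.

Import Order.TTheory GRing.Theory Num.Theory.
Import numFieldNormedType.Exports.

Local Open Scope classical_set_scope.
Local Open Scope ring_scope.

(* The image map is g = eta * G, where G' = 1 on the Cantor set supp mu. The
   Hölder function G' - 1 is a sum of bumps carried by the gaps, scaled so that
   at every level n the two branches of the Cantor construction are displaced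
   by l ^ n (1 - l) + d n instead of l ^ n (1 - l), with any prescribed d n of
   size at most e l ^ (n s). Since G translates cylinders, the Fourier transform
   of G mu still factors as a product of |cos (pi xi (l ^ n (1 - l) + d n))|.
   As long as xi l ^ (n s) is large, the mean over d n of the 2m-th power of the
   n-th factor is about that of cos ^ (2 m), so one choice of (d n) makes the
   products decay simultaneously at countably many frequencies, dense enough to
   control all the others by the Lipschitz property of the Fourier transform.
   For Pisot 1 / l, the powers of 1 / l approach the integers exponentially fast
   (their distance to the power sums of the conjugates), so that the product
   stays away from 0 along xi = l ^ (- k) / (1 - l). *)

(** * Hölder calculus on the unit interval *)

(** The exponent comes from a balance. Put q = l^s. A frequency xi sees about log xi / log (1/q)
    levels with xi q^n large, and each of them contributes about [cos_mean m] to the 2m-th power of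
    the transform. The controlled frequencies are j^(1/(1+tau)), and serving all of them with one
    sequence (d n) costs about xi^(1+tau). A decay xi^(-2 m tau) is left if cos_mean m < q^(1 + tau
    (2m+1)). Already tau = 0 asks for cos_mean m < q, and [cos_mean m] is of order m^(-1/2); so m is
    of order q^(-2), and tau log (1/q) of order q^2 = l^(2s).

    No probability is put on the displacements: they are fixed level by level, keeping a weighted
    sum over all frequencies at most 1.

    The size l^(ns) of d n is what C^s allows: a bump of height l^(n(s-1)) on a gap of length about
    l^n. The image is self-conformal because g conjugates the two affine contractions to maps whose
    derivatives stay below 1, G' being within 1/3 of 1 and l < 1/2. *)

Section smooth01.
Context {R : realType}.
Implicit Types (f g h : R -> R) (x y : R).

Lemma I01E x : I01 x = (0 <= x <= 1) :> Prop.
Proof. by rewrite /I01 /= in_itv. Qed.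

Lemma I01_0 : I01 (0 : R). Proof. by rewrite I01E lexx ler01. Qed.
Lemma I01_1 : I01 (1 : R). Proof. by rewrite I01E lexx ler01. Qed.

Lemma is_derive_cvg_quotient f x df : is_derive x 1 f df ->
  (f y - f x) / (y - x) @[y --> x^'] --> df.
Proof.
move=> /is_derive1_caratheodory[q [fq qc <-]].
have : q y @[y --> x^'] --> q x by apply: cvg_within_filter; exact: qc.
apply: cvg_trans; apply: near_eq_cvg.
near=> y; rewrite fq mulfK// subr_eq0.
by near: y; exact: nbhs_dnbhs_neq.
Unshelve. all: by end_near. Qed.

Lemma quotient_cvg_is_derive f x df :
  (f y - f x) / (y - x) @[y --> x^'] --> df -> is_derive x 1 f df.
Proof.
move=> fdf; apply/is_derive1_caratheodory.
exists (fun z => if z == x then df else (f z - f x) / (z - x)); split.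
- move=> z; case: eqP => [->|/eqP]; first by rewrite !subrr mulr0.
  by rewrite -subr_eq0 => /divfK->.
- apply/continuous_withinNx; rewrite eqxx.
  apply: cvg_trans fdf; apply: near_eq_cvg.
  by near=> z; rewrite ifN//; near: z; exact: nbhs_dnbhs_neq.
- by rewrite eqxx.
Unshelve. all: by end_near. Qed.

(** Serves where no local formula is at hand: at the kink of the positive part and at the points
    outside all gaps. *)
Lemma is_derive_little f x df (K b : R) : 0 < b ->
  (forall y, `|f y - f x - df * (y - x)| <= K * `|y - x| `^ (1 + b)) ->
  is_derive x 1 f df.
Proof.
move=> b0 fK; apply: quotient_cvg_is_derive.
apply/cvgrPdist_le => e e0.
have K0 : 0 < `|K| + 1 by rewrite ltr_wpDl.
set d := (e / (`|K| + 1)) `^ b^-1.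
have d0 : 0 < d by apply: powR_gt0; exact: divr_gt0.
near=> y.
have yx : y - x != 0 by rewrite subr_eq0; near: y; exact: nbhs_dnbhs_neq.
have nyx : 0 < `|y - x| by rewrite normr_gt0.
have yd : `|y - x| < d.
  by rewrite distrC; near: y; apply: nbhs_dnbhs; exact: nbhsx_ballx.
rewrite distrC -[X in _ - X](mulfK yx) -mulrBl normrM normfV.
rewrite ler_pdivrMr//; apply: (le_trans (fK y)).
have -> : `|y - x| `^ (1 + b) = `|y - x| * `|y - x| `^ b.
  by rewrite powRD ?(gt_eqF nyx) ?implybT// powRr1.
rewrite mulrCA mulrC ler_pM2r//.
apply: (@le_trans _ _ ((`|K| + 1) * d `^ b)); last first.
  rewrite -powRrM mulVf ?gt_eqF// powRr1; last by rewrite ltW// divr_gt0.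
  by rewrite mulrC divfK// gt_eqF.
apply: (@le_trans _ _ ((`|K| + 1) * `|y - x| `^ b)).
  by rewrite ler_wpM2r ?powR_ge0// (le_trans (ler_norm K))// lerDl.
rewrite ler_pM2l// ge0_ler_powR ?nnegrE ?ltW//.
Unshelve. all: by end_near. Qed.

(** [deriv01] is a [lim], which is determined only along a proper filter: every point of [0,1],
    endpoints included, must be a limit of other points of [0,1]. *)
Lemma within_I01_dnbhs_proper x : I01 x -> ProperFilter (within I01 x^').
Proof.
rewrite I01E => /andP[x0 x1]; apply: Build_ProperFilter_ex => P.
rewrite /within/= => -[/= e /= e0 He].
pose t := Num.min (e / 2) (1/2).
have t0 : 0 < t by rewrite lt_min !divr_gt0.
have te : t < e by rewrite gt_min ltr_pdivrMr// ltr_pMr// ltrDl ltr01.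
have t2 : t <= 1/2 by rewrite ge_min lexx orbT.
have [x2|x2] := leP x (1/2).
  exists (x + t); apply: (He (x + t)).
  - by rewrite /ball/= opprD addNKr normrN gtr0_norm.
  - by rewrite -subr_eq0 addrAC subrr add0r gt_eqF.
  - by rewrite I01E; lra.
exists (x - t); apply: (He (x - t)).
- by rewrite /ball/= opprB addrC subrK gtr0_norm.
- by rewrite -subr_eq0 addrAC subrr add0r oppr_eq0 gt_eqF.
- by rewrite I01E; lra.
Qed.

Lemma deriv01_is_derive f g x df : I01 x -> (forall y, I01 y -> f y = g y) ->
  is_derive x 1 g df -> derivable01 f x /\ deriv01 f x = df.
Proof.
move=> x01 fg gdf; have PF := within_I01_dnbhs_proper x01.
have fdf : diff_quotient01 f x --> df.
  have : (g y - g x) / (y - x) @[y --> within I01 x^'] --> df.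
    apply: cvg_trans (is_derive_cvg_quotient gdf).
    by apply: cvg_app; exact: cvg_within.
  apply: cvg_trans; apply: near_eq_cvg.
  by near=> y; rewrite !fg//; near: y; exact: withinT.
split; first by apply/cvg_ex; exists df.
by rewrite /deriv01; apply/cvg_lim.
Unshelve. all: by end_near. Qed.

Lemma eq_diff_quotient01 f g x : I01 x -> (forall y, I01 y -> f y = g y) ->
  diff_quotient01 f x = diff_quotient01 g x.
Proof.
move=> x01 fg; rewrite eqEsubset; split.
  apply: near_eq_cvg.
  by near=> y; rewrite !fg//; near: y; exact: withinT.
apply: near_eq_cvg.
by near=> y; rewrite !fg//; near: y; exact: withinT.
Unshelve. all: by end_near. Qed.

Lemma eq_deriv01n k f g : (forall y, I01 y -> f y = g y) ->
  forall y, I01 y -> deriv01n k f y = deriv01n k g y.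
Proof.
move=> fg; elim: k => [//|k IH] y y01.
by rewrite /deriv01n/= /deriv01 (eq_diff_quotient01 y01 IH).
Qed.

Lemma eq_derivable01 f g x : I01 x -> (forall y, I01 y -> f y = g y) ->
  derivable01 f x -> derivable01 g x.
Proof. by move=> x01 fg; rewrite /derivable01 (eq_diff_quotient01 x01 fg). Qed.

Lemma eq_within_I01_continuous f g : (forall y, I01 y -> f y = g y) ->
  {within I01, continuous f} -> {within I01, continuous g}.
Proof. by move=> fg; apply: subspace_eq_continuous => x; rewrite inE => /fg. Qed.

(* Functions of class C^{r,a} on [0,1] that are differentiable as functions on R,
   also at the endpoints. *)
Fixpoint smooth01 (r : nat) (a : R) f : Prop :=
  if r is r'.+1 then
    exists2 f' : R -> R, (forall x : R, I01 x -> is_derive x 1 f (f' x)) &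
      smooth01 r' a f'
  else exists2 K : R, 0 <= K &
    forall x y : R, I01 x -> I01 y -> `|f x - f y| <= K * `|x - y| `^ a.

Lemma I01_dist_le1 x y : I01 x -> I01 y -> `|x - y| <= 1.
Proof. by rewrite !I01E ler_norml => *; lra. Qed.

Lemma derivative_bounded_lipschitz f f' (K : R) :
  (forall x, I01 x -> is_derive x 1 f (f' x)) ->
  (forall x, I01 x -> `|f' x| <= K) ->
  forall x y, I01 x -> I01 y -> `|f x - f y| <= K * `|x - y|.
Proof.
move=> ff' f'K x y.
wlog xy : x y / x <= y.
  move=> W x01 y01; have [|/ltW] := leP x y; first by move/W; exact.
  by move/W => /(_ y01 x01); rewrite distrC [`|y - x|]distrC.
rewrite !I01E => x01 y01.
have in01 z : z \in `[x, y] -> I01 z.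
  by rewrite in_itv I01E /= => *; lra.
have dxy z : z \in `]x, y[ -> is_derive z 1 f (f' z).
  by move=> /subset_itv_oo_cc/in01; exact: ff'.
have cxy : {within `[x, y], continuous f}.
  by apply: derivable_within_continuous => z /in01 /ff'[].
have [c cxy' fyx] := MVT_segment xy dxy cxy.
rewrite distrC fyx normrM [`|x - y|]distrC ler_wpM2r//.
exact/f'K/in01.
Qed.

Lemma powR_le1 (t a : R) : 0 <= t <= 1 -> 0 <= a -> t `^ a <= 1.
Proof.
move=> /andP[t0 t1] a0; have -> : 1 = 1 `^ a :> R by rewrite powR1.
by rewrite ge0_ler_powR ?nnegrE.
Qed.

Lemma smooth01_bounded r a f : 0 < a -> smooth01 r a f ->
  exists2 K : R, 0 <= K & forall x, I01 x -> `|f x| <= K.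
Proof.
move=> a0; elim: r f => [f [K K0 fK]|r IH f [f' ff' /IH[K K0 f'K]]].
  exists (`|f 0| + K); first by rewrite addr_ge0.
  move=> x x01; rewrite -[f x](subrK (f 0)) addrC.
  rewrite (le_trans (ler_normD _ _))// lerD2l (le_trans (fK _ _ x01 I01_0))//.
  rewrite ler_piMr// powR_le1 ?(ltW a0)// normr_ge0 I01_dist_le1//.
  exact: I01_0.
exists (`|f 0| + K); first by rewrite addr_ge0.
move=> x x01.
rewrite -[f x](subrK (f 0)) addrC.
rewrite (le_trans (ler_normD _ _))// lerD2l.
rewrite (le_trans (derivative_bounded_lipschitz ff' f'K x01 I01_0))//.
by rewrite ler_piMr// I01_dist_le1//; exact: I01_0.
Qed.

Lemma smooth01_lipschitz r a f : 0 < a -> smooth01 r.+1 a f ->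
  exists2 K : R, 0 <= K &
    forall x y, I01 x -> I01 y -> `|f x - f y| <= K * `|x - y|.
Proof.
move=> a0 [f' ff' /(smooth01_bounded a0)[K K0 f'K]].
by exists K => //; exact: derivative_bounded_lipschitz ff' f'K.
Qed.

(** Distances in [0,1] are at most 1, so |x - y| <= |x - y|^a for a <= 1. *)
Lemma lipschitz_smooth01 a f (K : R) : 0 < a <= 1 -> 0 <= K ->
  (forall x y, I01 x -> I01 y -> `|f x - f y| <= K * `|x - y|) ->
  smooth01 0 a f.
Proof.
move=> /andP[a0 a1] K0 fK; exists K => // x y x01 y01.
rewrite (le_trans (fK _ _ x01 y01))// ler_wpM2l//.
have [->|xy] := eqVneq x y; first by rewrite subrr normr0 powR_ge0.
by rewrite ger1_powR// normr_gt0 subr_eq0 xy I01_dist_le1.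
Qed.

Lemma smooth01W r a f : 0 < a <= 1 -> smooth01 r.+1 a f -> smooth01 r a f.
Proof.
move=> a01; have /andP[a0 a1] := a01; elim: r f => [f|r IH f [f' ff' /IH]].
  by move=> /(smooth01_lipschitz a0)[K K0 fK]; exact: lipschitz_smooth01 fK.
by exists f'.
Qed.

Lemma smooth01_continuous r a f : 0 < a -> smooth01 r a f ->
  {within I01, continuous f}.
Proof.
case: r => [|r] a0; last first.
  move=> [f' ff' _]; apply: continuous_in_subspaceT => x.
  by rewrite inE => /ff'[/derivable1_diffP/differentiable_continuous].
move=> [K K0 fK]; apply/subspace_continuousP => x x01.
apply/cvgrPdist_le => e e0.
have K1 : 0 < K + 1 by rewrite ltr_wpDl.
set d := (e / (K + 1)) `^ a^-1.
have d0 : 0 < d by apply: powR_gt0; exact: divr_gt0.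
near=> y.
have y01 : I01 y by near: y; exact: withinT.
have yd : `|x - y| < d by near: y; apply: cvg_within; exact: nbhsx_ballx.
rewrite (le_trans (fK _ _ x01 y01))//.
apply: (@le_trans _ _ ((K + 1) * d `^ a)); last first.
  rewrite -powRrM mulVf ?gt_eqF// powRr1; last by rewrite ltW// divr_gt0.
  by rewrite mulrC divfK// gt_eqF.
apply: ler_pM; rewrite ?powR_ge0// ?lerDl//.
by apply: ge0_ler_powR; rewrite ?nnegrE ?(ltW a0)// ltW.
Unshelve. all: by end_near. Qed.

Lemma smooth01_holder r a f : 0 < a <= 1 -> smooth01 r a f -> holder01 a f.
Proof.
move=> a01; elim: r => [[K K0 fK]|r IH /(smooth01W a01)//].
by exists K => x y; rewrite !inE; exact: fK.
Qed.

Lemma smooth01_Cralpha01 r a f : 0 < a <= 1 -> smooth01 r a f ->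
  Cralpha01 r a f.
Proof.
move=> a01; have /andP[a0 a1] := a01; elim: r f => [|r IH] f sf.
  split; last exact: smooth01_holder sf.
  split=> // k; rewrite leqn0 => /eqP -> /=.
  exact: smooth01_continuous sf.
have fc := smooth01_continuous a0 sf.
case: sf => f' ff' /IH[[f'd f'c] [K f'K]].
have f'E y : I01 y -> deriv01 f y = f' y.
  by move=> y01; have [] := deriv01_is_derive y01 (fun _ _ => erefl) (ff' _ y01).
have itE k y : I01 y -> deriv01n k f' y = deriv01n k.+1 f y.
  move=> y01; rewrite /deriv01n iterSr; apply/esym.
  exact: (eq_deriv01n k f'E).
split; first split.
- case=> [_|k kr] x; rewrite inE => x01.
    by have [] := deriv01_is_derive x01 (fun _ _ => erefl) (ff' _ x01).
  by apply: (eq_derivable01 x01 (itE k)); apply: f'd; rewrite ?inE.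
- case=> [_|k kr]; first exact: fc.
  exact: eq_within_I01_continuous (itE k) (f'c k kr).
- exists K => x y; rewrite !inE => x01 y01.
  by rewrite -(itE _ _ x01) -(itE _ _ y01); apply: f'K; rewrite inE.
Qed.

Lemma smooth01_cst r a (c : R) : smooth01 r a (cst c).
Proof.
elim: r c => [|r IH] c.
  by exists 0 => // x y _ _; rewrite subrr normr0 mul0r.
by exists (cst 0) => [x _|//]; exact: is_derive_cst.
Qed.

Lemma smooth01D r a f g : smooth01 r a f -> smooth01 r a g ->
  smooth01 r a (f \+ g).
Proof.
elim: r f g => [|r IH] f g.
  move=> [K K0 fK] [L L0 gL]; exists (K + L); first exact: addr_ge0.
  move=> x y x01 y01; rewrite opprD addrACA (le_trans (ler_normD _ _))//.
  by rewrite mulrDl lerD ?fK ?gL.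
move=> [f' ff' sf'] [g' gg' sg']; exists (f' \+ g'); last exact: IH.
by move=> x x01; apply: is_deriveD; [exact: ff'|exact: gg'].
Qed.

Lemma smooth01M r a f g : 0 < a <= 1 -> smooth01 r a f -> smooth01 r a g ->
  smooth01 r a (f \* g).
Proof.
move=> a01; have /andP[a0 a1] := a01; elim: r f g => [|r IH] f g sf sg.
  have [A A0 fA] := smooth01_bounded a0 sf.
  have [B B0 gB] := smooth01_bounded a0 sg.
  case: sf sg => [K K0 fK] [L L0 gL]; exists (A * L + B * K).
    by rewrite addr_ge0// mulr_ge0.
  move=> x y x01 y01 /=.
  have -> : f x * g x - f y * g y = f x * (g x - g y) + g y * (f x - f y).
    by ring.
  rewrite (le_trans (ler_normD _ _))// mulrDl !normrM -!mulrA.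
  by rewrite lerD// ler_pM// ?fA ?gB ?fK ?gL.
have sf0 := smooth01W a01 sf; have sg0 := smooth01W a01 sg.
case: sf sg => [f' ff' sf'] [g' gg' sg'].
exists ((f \* g') \+ (g \* f')); last by apply: smooth01D; exact: IH.
move=> x x01; have [f'x g'x] := (ff' x x01, gg' x x01).
exact: (is_derive_eq (is_deriveM _ _)).
Qed.

Lemma smooth01_affine r a (b c : R) : 0 < a <= 1 ->
  smooth01 r a (fun x => b * x + c).
Proof.
move=> a01; case: r => [|r].
  apply: (@lipschitz_smooth01 _ _ `|b|) => // x y _ _.
  have -> : b * x + c - (b * y + c) = b * (x - y) by ring.
  by rewrite normrM.
exists (cst b); last exact: smooth01_cst.
move=> x _.
apply: (is_derive_eq (is_deriveD (is_deriveZ b (is_derive_id x 1)) (is_derive_cst c x 1))).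
by rewrite addr0 /GRing.scale/= mulr1.
Qed.

(* For r = 0, h merely a-Hölder would only make f \o h a^2-Hölder, whence the
   Lipschitz hypothesis. *)
Lemma smooth01_comp r a f h (K : R) : 0 < a <= 1 ->
  (forall x, I01 x -> I01 (h x)) -> 0 <= K ->
  (forall x y, I01 x -> I01 y -> `|h x - h y| <= K * `|x - y|) ->
  smooth01 r a f -> smooth01 r a h -> smooth01 r a (f \o h).
Proof.
move=> a01 hI K0 hK; have /andP[a0 a1] := a01.
elim: r f => [|r IH] f.
  move=> [L L0 fL] _; exists (L * K `^ a); first by rewrite mulr_ge0 ?powR_ge0.
  move=> x y x01 y01 /=; rewrite (le_trans (fL _ _ (hI _ x01) (hI _ y01)))//.
  rewrite -mulrA ler_wpM2l// -powRM// ge0_ler_powR ?nnegrE ?mulr_ge0 ?(ltW a0)//.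
  exact: hK.
move=> [f' ff' sf'] sh; have sh0 := smooth01W a01 sh.
case: sh => [h' hh' sh']; exists ((f' \o h) \* h').
  move=> x x01; have fx := ff' _ (hI _ x01); have hx := hh' _ x01.
  exact: is_derive1_comp.
by apply: smooth01M => //; exact: IH.
Qed.

Lemma smooth01V r a f (c : R) : 0 < a <= 1 -> 0 < c ->
  (forall x, I01 x -> c <= f x) -> smooth01 r a f ->
  smooth01 r a (fun x => (f x)^-1).
Proof.
move=> a01 c0 cf; have f0 x : I01 x -> 0 < f x.
  by move=> /cf; exact: lt_le_trans.
elim: r => [|r IH].
  move=> [K K0 fK]; exists (c^-2 * K).
    by rewrite mulr_ge0// invr_ge0 exprn_ge0// ltW.
  move=> x y x01 y01.
  have fx := f0 _ x01; have fy := f0 _ y01.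
  have -> : (f x)^-1 - (f y)^-1 = (f x * f y)^-1 * (f y - f x).
    by field; rewrite !gt_eqF.
  rewrite normrM [`|f y - _|]distrC -mulrA ler_pM//; last exact: fK.
  rewrite gtr0_norm ?invr_gt0 ?mulr_gt0// lef_pV2 ?posrE ?mulr_gt0 ?exprn_gt0//.
  by rewrite expr2 ler_pM ?cf// ltW.
move=> sf; have sf0 := smooth01W a01 sf; case: sf => f' ff' sf'.
exists (cst (-1) \* (f' \* ((fun x => (f x)^-1) \* (fun x => (f x)^-1)))).
  move=> x x01; have fx := ff' _ x01.
  apply: (is_derive_eq (is_deriveV _ fx)); first by rewrite gt_eqF// f0.
  by rewrite /GRing.scale/= expr2 invfM; ring.
by do 3?[apply: smooth01M => //]; [exact: smooth01_cst|exact: IH|exact: IH].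
Qed.

(** Bootstrap on h' = 1 / (f' o h): once h is of class k, so is the right-hand side, and h gains one
    derivative. The start is the Lipschitz bound 1 / c. *)
Lemma smooth01_inverse r a f f' h (c : R) : 0 < a <= 1 -> 0 < c ->
  (forall x, I01 x -> is_derive x 1 f (f' x)) ->
  (forall x, I01 x -> c <= f' x) ->
  smooth01 r a f' ->
  (forall x, I01 x -> I01 (h x)) ->
  (forall x, I01 x -> is_derive x 1 h (f' (h x))^-1) ->
  smooth01 r.+1 a h.
Proof.
move=> a01 c0 ff' cf' sf' hI hh'; have /andP[a0 a1] := a01.
have c1 : 0 <= c^-1 by rewrite invr_ge0 ltW.
have hK x y : I01 x -> I01 y -> `|h x - h y| <= c^-1 * `|x - y|.
  apply: (derivative_bounded_lipschitz hh') => {}x /hI/cf' cx.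
  have f'0 := lt_le_trans c0 cx.
  by rewrite gtr0_norm ?invr_gt0// lef_pV2.
have key k : smooth01 k a f' -> smooth01 k a h -> smooth01 k.+1 a h.
  move=> sk hk; exists (fun x => (f' (h x))^-1) => //.
  apply: (@smooth01V _ _ (f' \o h) c) => //; first by move=> x /hI/cf'.
  exact: (smooth01_comp a01 hI c1 hK).
elim: r sf' => [|r IH] sf'.
  by apply: key => //; exact: (lipschitz_smooth01 a01 c1 hK).
by apply: key => //; apply: IH; exact: smooth01W.
Qed.

End smooth01.

(** * A smooth bump on the middle gap *)

Section bump.
Context {R : realType}.

(** Only the square needs an estimate, with a remainder of at most (y - x)^2; higher powers follow
    from the product rule, a power of the positive part being y times the preceding one. *)
Lemma is_derive_pospart_pow (n : nat) (x : R) :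
  is_derive x 1 (fun y : R => Num.max 0 y ^+ n.+2)
    (n.+2%:R * Num.max 0 x ^+ n.+1).
Proof.
elim: n x => [|n IH] x.
  apply: (@is_derive_little _ _ _ _ 1 1) => // y.
  rewrite mul1r -[1 + 1]/(2%:R) powR_mulrn// real_normK ?num_real// expr1.
  have h1 := sqr_ge0 x; have h2 := sqr_ge0 y.
  have [x0|x0] := leP 0 x; have [y0|y0] := leP 0 y; rewrite ler_norml.
  - by have := sqr_ge0 (y - x); rewrite !expr2 => h3; apply/andP; split; lra.
  - have xy : x * y <= 0 by apply: mulr_ge0_le0 => //; exact: ltW.
    by move: h1 h2; rewrite !expr2 => h1 h2; apply/andP; split; lra.
  - have xy : x * y <= 0 by apply: mulr_le0_ge0 => //; exact: ltW.
    by move: h1 h2; rewrite !expr2 => h1 h2; apply/andP; split; lra.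
  - by have := sqr_ge0 (y - x); rewrite !expr2 => h3; apply/andP; split; lra.
have -> : (fun y : R => Num.max 0 y ^+ n.+3) = id \* (fun y => Num.max 0 y ^+ n.+2).
  apply/funext => y /=; rewrite [LHS]exprS.
  by have [|] := leP 0 y => // _; rewrite !mul0r exprS mul0r mulr0.
apply: (is_derive_eq (is_deriveM (is_derive_id x 1) (IH x))).
rewrite /GRing.scale/= mulr1.
have -> : n.+3%:R = n.+2%:R + 1 :> R by rewrite natr1.
rewrite ![Num.max 0 x ^+ n.+2]exprS.
have [x0|x0] := leP 0 x; first by ring.
by rewrite !exprS !mul0r !mulr0 add0r.
Qed.

(** Integrating from -oo, which the vanishing outside [0,1] permits, gives the derivative at every
    real point at once. *)
Lemma antiderivative (f : R -> R) : continuous f ->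
  (forall x, ~ I01 x -> f x = 0) -> exists F : R -> R, forall x : R, is_derive x 1 F (f x).
Proof.
move=> fc f0; pose mu := @lebesgue_measure R.
have fi : mu.-integrable setT (EFin \o f).
  have : mu.-integrable `[0, 1]%classic (EFin \o f).
    apply: continuous_compact_integrable; first exact: segment_compact.
    exact: continuous_subspaceT.
  move/integrable_mkcond => /(_ (measurable_itv _)).
  congr (mu.-integrable _ _); apply/funext => x; rewrite patchE.
  by case: ifPn => //; rewrite notin_setE => /f0 /= ->.
exists (fun x => \int[mu]_(t in [set` Interval -oo%O (BRight x)]) f t) => x.
have fi' u : mu.-integrable [set` Interval -oo%O (BRight u)] (EFin \o f).
  exact: (integrableS _ _ _ fi).
have x1 : x < x + 1 by rewrite ltrDl.
have [] := @continuous_FTC1 R f -oo%O x (x + 1) x1 (fi' _) _ (fc x).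
  by rewrite ltNyr.
by rewrite derive1E => ? ?; exact: DeriveDef.
Qed.

Lemma horner_bounded (q : {poly R}) :
  exists2 C : R, 0 < C & forall x, I01 x -> `|q.[x]| <= C.
Proof.
exists (1 + \sum_(i < size q) `|q`_i|); first by rewrite ltr_pwDl// sumr_ge0.
move=> x; rewrite I01E => /andP[x0 x1].
rewrite horner_coef (le_trans (ler_norm_sum _ _ _))//.
rewrite ler_wpDl// ler_sum// => i _.
by rewrite normrM ler_piMr// normrX ger0_norm// exprn_ile1.
Qed.

Definition gap (l : R) : set R := [set x | l < x < 1 - l].

(* Every b k is a polynomial times a power of the positive part of
   (x - l) (1 - l - x), of exponent at least 2 as long as k <= p. *)
Lemma bump_family (l : R) (p : nat) : 0 < l < 1 / 2 ->
  exists (b : nat -> R -> R) (M : R),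
  0 < M /\ continuous (b 0%N) /\
  [/\ forall k (x : R), (k < p)%N -> is_derive x 1 (b k) (b k.+1 x),
      forall k x, (k <= p)%N -> ~ gap l x -> b k x = 0,
      forall k x y (t : R), (k <= p)%N -> gap l x -> ~ gap l y -> 0 < t <= 2 ->
        `|b k x| <= M * `|x - y| `^ t,
      forall x y, I01 x -> I01 y -> `|b p x - b p y| <= M * `|x - y| &
      forall x, gap l x -> 0 < b 0%N x].
Proof.
move=> /andP[l0 l2].
pose U : {poly R} := ('X - l%:P) * ((1 - l)%:P - 'X).
have UE x : U.[x] = (x - l) * (1 - l - x) by rewrite /U !hornerE.
clearbody U.
(* Leibniz rule with one factor pulled out: the derivative of P U^N is (P' U + N P U') U^(N-1), here
   with N = p + 2 - j. *)
pose P := fix P k : {poly R} := if k is j.+1 then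
  (P j)^`() * U + (p + 2 - j)%:R *: (P j * U^`()) else 1.
pose b k x := (P k).[x] * Num.max 0 U.[x] ^+ (p + 2 - k).
have bd k (x : R) : (k <= p)%N -> is_derive x 1 (b k) (b k.+1 x).
  move=> kp; have [q qE] : exists q, (p + 2 - k = q.+2)%N by exists (p - k)%N; lia.
  rewrite /b (_ : p + 2 - k.+1 = q.+1)%N; last by lia.
  rewrite qE; have dU := is_derive1_comp (is_derive_pospart_pow q U.[x]) (is_derive_poly U x).
  apply: (is_derive_eq (is_deriveM (is_derive_poly (P k) x) dU)).
  rewrite /= qE /GRing.scale/= hornerD hornerZ !hornerM !exprS.
  move: (q.+2%:R : R) (P k)^`().[x] U^`().[x] => c P' U'.
  have [u0|u0] := leP 0 U.[x]; first by ring.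
  by rewrite !(mul0r, mulr0) add0r.
have Ug x : ~ gap l x -> U.[x] <= 0.
  rewrite /gap/= UE => /negP; rewrite negb_and -!leNgt => /orP[|] xl.
    by rewrite mulr_le0_ge0 ?subr_le0 ?subr_ge0//; lra.
  by rewrite mulr_ge0_le0 ?subr_le0 ?subr_ge0//; lra.
have gU x : gap l x -> 0 < U.[x] <= 1.
  rewrite /gap/= UE => /andP[lx xl]; rewrite mulr_gt0 ?subr_gt0//=.
  by rewrite mulr_ile1 ?subr_ge0 ?ltW//; lra.
(* Each factor of [U] is at most 1 and is the distance of x to one edge of the gap, and y lies
   beyond an edge. *)
have dU x y : gap l x -> ~ gap l y -> U.[x] <= `|x - y|.
  rewrite /gap/= UE => /andP[lx xl] /negP.
  rewrite negb_and -!leNgt => /orP[|] ly.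
    rewrite (le_trans _ (ler_norm _))// (@le_trans _ _ (x - l))//; last by lra.
    by rewrite ler_piMr; lra.
  rewrite distrC (le_trans _ (ler_norm _))// (@le_trans _ _ (1 - l - x))//; last by lra.
  by rewrite ler_piMl; lra.
have [C C0 PC] : exists2 C : R, 0 < C & forall k x, (k <= p.+1)%N -> I01 x -> `|(P k).[x]| <= C.
  elim: (p.+1) => [|m [C C0 PC]].
    by exists 1 => // k x; rewrite leqn0 => /eqP -> _; rewrite hornerE normr1.
  have [D D0 PD] := horner_bounded (P m.+1).
  exists (C + D); first exact: addr_gt0.
  move=> k x; rewrite leq_eqVlt => /orP[/eqP -> x01|km x01].
    by rewrite ler_wpDl ?(ltW C0)// PD.
  by rewrite ler_wpDr ?(ltW D0)// PC.
have gI x : gap l x -> I01 x by rewrite /gap/= I01E => /andP[? ?]; lra.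
have b0 k x : (k <= p)%N -> ~ gap l x -> b k x = 0.
  move=> kp /Ug Ux; rewrite /b (max_idPl Ux).
  rewrite (_ : p + 2 - k = (p - k).+2)%N; last by lia.
  by rewrite exprS mul0r mulr0.
have Umax x : I01 x -> 0 <= Num.max 0 U.[x] <= 1.
  move=> x01; rewrite le_max lexx/= ge_max ler01/=.
  have [/gU/andP[]//|/Ug] := pselect (gap l x).
  by move=> /le_trans; apply.
exists b, C; split=> //; split.
  move=> x; apply/differentiable_continuous/derivable1_diffP.
  by have [] := bd 0%N x (leq0n _).
split=> //.
- by move=> k x /ltnW; exact: bd.
- move=> k x y t kp gx gy /andP[t0 t2].
  rewrite normrM ler_pM//; first by apply: PC; [exact: leqW|exact: gI].
  have /andP[U0 U1] := gU _ gx.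
  rewrite (max_idPr (ltW U0)) ger0_norm ?exprn_ge0 ?(ltW U0)//.
  apply: (@le_trans _ _ (U.[x] `^ t)); last first.
    by rewrite ge0_ler_powR ?nnegrE ?(ltW t0) ?(ltW U0)//; exact: dU.
  rewrite -powR_mulrn ?(ltW U0)// ger_powR ?U0//.
  by rewrite (le_trans t2)// ler_nat; lia.
- apply: derivative_bounded_lipschitz => [x _|x x01]; first exact: bd.
  rewrite normrM -[C]mulr1 ler_pM//; first exact: PC.
  have /andP[M0 M1] := Umax _ x01.
  by rewrite ger0_norm ?exprn_ge0// exprn_ile1.
- move=> x /gU/andP[U0 _]; rewrite /b/= hornerE mul1r exprn_gt0//.
  by rewrite lt_max U0 orbT.
Qed.

End bump.

(** * Bumps in the gaps of the Cantor set *)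

Section gaps.
Context {R : realType} (l : R).
Hypotheses (l0 : 0 < l) (l2 : l < 1 / 2).
Implicit Types (x y : R).

(* lra ignores section hypotheses. *)
Ltac slra := move: (l0) (l2) => ? ?; lra.

Definition inv0 x := x / l.
Definition inv1 x := (x - (1 - l)) / l.

Lemma is_derive_inv0 x : is_derive x 1 inv0 l^-1.
Proof.
apply: (is_derive_eq (is_deriveM (is_derive_id x 1) (is_derive_cst l^-1 x 1))).
by rewrite scaler0 add0r /GRing.scale/= mulr1.
Qed.

Lemma is_derive_inv1 x : is_derive x 1 inv1 l^-1.
Proof.
apply: (is_derive_eq (is_deriveM (is_deriveB (is_derive_id x 1)
  (is_derive_cst (1 - l) x 1)) (is_derive_cst l^-1 x 1))).
by rewrite scaler0 add0r subr0 /GRing.scale/= mulr1.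
Qed.

(** The union of the 2^n gaps of generation n. Pulling back by the two expanding branches avoids
    naming the gaps by words in {0,1}. *)
Fixpoint gapn n x : Prop :=
  if n is m.+1 then gapn m (inv0 x) \/ gapn m (inv1 x) else gap l x.

Lemma inv0_dist x y : `|inv0 x - inv0 y| = l^-1 * `|x - y|.
Proof.
by rewrite /inv0 -mulrBl normrM normfV (gtr0_norm l0) mulrC.
Qed.

Lemma inv1_dist x y : `|inv1 x - inv1 y| = l^-1 * `|x - y|.
Proof.
rewrite /inv1 -mulrBl normrM normfV (gtr0_norm l0) mulrC.
by congr (_ * `|_|); ring.
Qed.

Lemma gapn01 n x : gapn n x -> 0 < x < 1.
Proof.
elim: n x => [x|n IH x] /=; first by move=> /andP[? ?]; slra.
case=> /IH; rewrite /inv0 /inv1 ltr_pdivlMr// mul0r ltr_pdivrMr// mul1r.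
  by move=> /andP[? ?]; slra.
by move=> /andP[? ?]; slra.
Qed.

(** The images [0, l] and [1 - l, 1] of the contractions are disjoint, so from a deeper gap only one
    inverse branch lands in (0,1). Inductions over levels split along this alternative. *)
Lemma gapnS n x : gapn n.+1 x ->
  [/\ x < l, gapn n (inv0 x) & forall m, ~ gapn m (inv1 x)] \/
  [/\ 1 - l < x, gapn n (inv1 x) & forall m, ~ gapn m (inv0 x)].
Proof.
move=> [] g; have /andP[] := gapn01 g; rewrite /inv0 /inv1.
  rewrite ltr_pdivlMr// mul0r ltr_pdivrMr// mul1r => x0 xl; left; split => //.
  move=> m /gapn01/andP[]; rewrite ltr_pdivlMr// mul0r => ? _; slra.
rewrite ltr_pdivlMr// mul0r ltr_pdivrMr// mul1r => x0 xl; right; split => //.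
  by slra.
move=> m /gapn01/andP[_]; rewrite ltr_pdivrMr// mul1r => ?; slra.
Qed.

Lemma gapn_inj n m x : gapn n x -> gapn m x -> n = m.
Proof.
elim: n m x => [|n IH] [|m] x //.
- move=> /andP[? ?] /gapnS[[? _ _]|[? _ _]]; exfalso; slra.
- move=> /gapnS[[? _ _]|[? _ _]] /andP[? ?]; exfalso; slra.
- move=> /gapnS[[_ gn Nn]|[_ gn Nn]] /= [gm|gm].
  + by rewrite (IH _ _ gn gm).
  + by case: (Nn m).
  + by case: (Nn m).
  + by rewrite (IH _ _ gn gm).
Qed.

Lemma open_gapn n : open [set x | gapn n x].
Proof.
elim: n => [|n IH].
  rewrite (_ : [set x | _] = `]l, 1 - l[%classic); first exact: interval_open.
  by apply/seteqP; split=> x /=; rewrite in_itv.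
have -> : [set x | gapn n.+1 x] =
    inv0 @^-1` [set x | gapn n x] `|` inv1 @^-1` [set x | gapn n x] by [].
apply: openU; apply: open_comp => // x _.
  by have [/derivable1_diffP/differentiable_continuous] := is_derive_inv0 x.
by have [/derivable1_diffP/differentiable_continuous] := is_derive_inv1 x.
Qed.

Lemma gapn_lM n x : I01 x -> (gapn n (l * x) <-> exists2 m, n = m.+1 & gapn m x).
Proof.
rewrite I01E => /andP[x0 x1].
have i0 : inv0 (l * x) = x by rewrite /inv0 mulrC mulKf// gt_eqF.
have i1 m : ~ gapn m (inv1 (l * x)).
  move=> /gapn01/andP[]; rewrite /inv1 ltr_pdivlMr// mul0r => + _.
  by have := ler_pM2l l0 x 1; rewrite x1 mulr1; slra.
case: n => [|n]; split.
- by move=> /andP[+ _]; rewrite -[ltLHS]mulr1 ltr_pM2l//; slra.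
- by case.
- by move=> [|/i1//]; rewrite i0; exists n.
- by move=> [m [->]] ? /=; rewrite i0; left.
Qed.

Lemma gapn_lMD n x : I01 x ->
  (gapn n (1 - l + l * x) <-> exists2 m, n = m.+1 & gapn m x).
Proof.
rewrite I01E => /andP[x0 x1].
have i1 : inv1 (1 - l + l * x) = x.
  by rewrite /inv1 addrAC subrr add0r mulrC mulKf// gt_eqF.
have lx : 0 <= l * x by rewrite mulr_ge0// ltW.
have i0 m : ~ gapn m (inv0 (1 - l + l * x)).
  by move=> /gapn01/andP[_]; rewrite /inv0 ltr_pdivrMr// mul1r => ?; slra.
case: n => [|n]; split.
- by move=> /andP[_] ?; slra.
- by case.
- by move=> [/i0//|]; rewrite i1; exists n.
- by move=> [m [->]] ? /=; rewrite i1; right.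
Qed.

End gaps.

Section bump_series.
Context {R : realType} (l : R).
Hypotheses (l0 : 0 < l) (l2 : l < 1 / 2).
Implicit Types (x y : R).
Ltac slra := move: (l0) (l2) => ? ?; lra.

Variables (p : nat) (a : R).
Hypothesis a01 : 0 < a <= 1.
Let a0 : 0 < a. Proof. by case/andP: a01. Qed.

Variables (b : nat -> R -> R) (M : R).
Hypothesis M0 : 0 < M.
Hypothesis bD : forall k x, (k < p)%N -> is_derive x 1 (b k) (b k.+1 x).
Hypothesis b_out : forall k x, (k <= p)%N -> ~ gap l x -> b k x = 0.
Hypothesis b_decay : forall k x y (t : R), (k <= p)%N -> gap l x -> ~ gap l y ->
  0 < t <= 2 -> `|b k x| <= M * `|x - y| `^ t.
Hypothesis b_lip : forall x y, I01 x -> I01 y ->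
  `|b p x - b p y| <= M * `|x - y|.

(* The k-th derivative of the sum of the copies of b 0 rescaled to the gaps of
   level n. *)
Fixpoint bumps n k x : R :=
  if n is m.+1 then l^-1 ^+ k * (bumps m k (inv0 l x) + bumps m k (inv1 l x))
  else b k x.

Lemma bumps_out n k x : (k <= p)%N -> ~ gapn l n x -> bumps n k x = 0.
Proof.
move=> kp; elim: n x => [x|n IH x] /=; first exact: b_out.
by move=> /not_orP[g0 g1]; rewrite !IH// addr0 mulr0.
Qed.

Lemma is_derive_bumps n k x : (k < p)%N ->
  is_derive x 1 (bumps n k) (bumps n k.+1 x).
Proof.
move=> kp; elim: n x => [x|n IH x] /=; first exact: bD.
have d0 := is_derive1_comp (IH (inv0 l x)) (is_derive_inv0 l x).
have d1 := is_derive1_comp (IH (inv1 l x)) (is_derive_inv1 l x).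
apply: (is_derive_eq (is_deriveZ (l^-1 ^+ k) (is_deriveD d0 d1))).
by rewrite /GRing.scale/= exprS; ring.
Qed.

Let L0 : 0 < l^-1. Proof. by rewrite invr_gt0. Qed.

(** Passing to the next level multiplies the k-th derivative by l^-k and distances by l^-1. *)
Lemma bumps_decay n k x y (t : R) : (k <= p)%N -> 0 < t <= 2 ->
  gapn l n x -> ~ gapn l n y ->
  `|bumps n k x| <= M * l^-1 ^+ (n * k) * (l^-1 ^+ n * `|x - y|) `^ t.
Proof.
move=> kp t02; elim: n x y => [x y|n IH x y].
  by rewrite mul0n !expr0 mulr1 mul1r => gx gy; exact: b_decay.
move=> /(gapnS l0 l2) g /= /not_orP[g0 g1].
have L1 : 0 <= l^-1 ^+ k by rewrite exprn_ge0// ltW.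
rewrite mulSn exprD [l^-1 ^+ n.+1]exprSr normrM (ger0_norm L1).
rewrite [M * (_ * _)]mulrCA -!mulrA ler_wpM2l// mulrA.
case: g => -[_ gx Nx].
- by rewrite (bumps_out kp (Nx n)) addr0 -(inv0_dist l0); exact: IH.
- by rewrite (bumps_out kp (Nx n)) add0r -(inv1_dist l0); exact: IH.
Qed.

(** For points in different branches the two values are bounded separately by [bumps_decay]: under
    the inverse branch that keeps one point in a gap, the other leaves all gaps. This gives the
    factor 2, the same at all levels. *)
Lemma bumps_holder n x y : 
  `|bumps n p x - bumps n p y| <=
    2 * M * l^-1 ^+ (n * p) * (l^-1 ^+ n * `|x - y|) `^ a.
Proof.
have a02 : 0 < a <= 2 by case/andP: a01 => -> /=; lra.
have M2 m : M * l^-1 ^+ (m * p) <= 2 * M * l^-1 ^+ (m * p).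
  have := exprn_gt0 (m * p) L0.
  by move=> e0; rewrite -mulrA ler_peMl ?ler1n// mulr_ge0// ltW.
have half m u v : gapn l m u -> ~ gapn l m v ->
  `|bumps m p u - bumps m p v| <=
    2 * M * l^-1 ^+ (m * p) * (l^-1 ^+ m * `|u - v|) `^ a.
  move=> gu gv; rewrite (bumps_out (leqnn p) gv) subr0.
  rewrite (le_trans (bumps_decay (leqnn p) a02 gu gv))//.
  by rewrite ler_wpM2r// powR_ge0.
elim: n x y => [x y|n IH x y].
  have [gx|gx] := pselect (gapn l 0 x); have [gy|gy] := pselect (gapn l 0 y).
  - have xI : I01 x by move: gx => /(gapn01 l0 l2); rewrite I01E => /andP[? ?]; lra.
    have yI : I01 y by move: gy => /(gapn01 l0 l2); rewrite I01E => /andP[? ?]; lra.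
    rewrite (le_trans (b_lip xI yI))// ler_pM ?(ltW M0)//.
      by rewrite mul0n expr0 mulr1 ler_peMl ?ler1n// ltW.
    rewrite expr0 mul1r; have [->|xy] := eqVneq x y.
      by rewrite subrr normr0 powR_ge0.
    case/andP: a01 => _ a1.
    by rewrite ger1_powR// normr_gt0 subr_eq0 xy I01_dist_le1.
  - exact: half.
  - by rewrite distrC [`|x - y|]distrC; exact: half.
  - by rewrite !bumps_out// subrr normr0 mulr_ge0 ?powR_ge0// mulr_ge0 ?mulr_ge0 ?(ltW M0)// exprn_ge0// ltW.
have [gx|gx] := pselect (gapn l n.+1 x); last first.
  have [gy|gy] := pselect (gapn l n.+1 y).
    by rewrite distrC [`|x - y|]distrC; exact: half.
  by rewrite !bumps_out// subrr normr0 mulr_ge0 ?powR_ge0// mulr_ge0 ?mulr_ge0 ?(ltW M0)// exprn_ge0// ltW.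
have [gy|gy] := pselect (gapn l n.+1 y); last exact: half.
have L1 : 0 <= l^-1 ^+ p by rewrite exprn_ge0// ltW.
have Es : l^-1 ^+ n.+1 * `|x - y| = l^-1 ^+ n * (l^-1 * `|x - y|).
  by rewrite exprSr mulrA.
have Ep : 2 * M * l^-1 ^+ (n.+1 * p) = l^-1 ^+ p * (2 * M * l^-1 ^+ (n * p)).
  by rewrite mulSn exprD; ring.
rewrite Es Ep -[leRHS]mulrA /= -mulrBr normrM (ger0_norm L1) ler_wpM2l//.
have mixed u v : gapn l n (inv0 l u) -> (forall m, ~ gapn l m (inv1 l u)) ->
    gapn l n (inv1 l v) -> (forall m, ~ gapn l m (inv0 l v)) ->
  `|bumps n p (inv0 l u) + bumps n p (inv1 l u) -
    (bumps n p (inv0 l v) + bumps n p (inv1 l v))| <=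
  2 * M * l^-1 ^+ (n * p) * (l^-1 ^+ n * (l^-1 * `|u - v|)) `^ a.
  move=> gu Nu gv Nv.
  rewrite (bumps_out _ (Nu n))// (bumps_out _ (Nv n))// addr0 add0r.
  rewrite (le_trans (ler_normB _ _))//.
  rewrite -mulrA [leRHS](_ : _ = M * (l^-1 ^+ (n * p)) * (l^-1 ^+ n * (l^-1 * `|u - v|)) `^ a + M * (l^-1 ^+ (n * p)) * (l^-1 ^+ n * (l^-1 * `|u - v|)) `^ a).
    apply: lerD.
      by rewrite -(inv0_dist l0); exact: bumps_decay.
    by rewrite -(inv1_dist l0) [`|inv1 l u - _|]distrC; exact: bumps_decay.
  by ring.
case: (gapnS l0 l2 gx) (gapnS l0 l2 gy) => -[_ hx Nx] [] [_ hy Ny].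
- rewrite (bumps_out _ (Nx n))// (bumps_out _ (Ny n))// !addr0 -(inv0_dist l0).
  exact: IH.
- exact: mixed.
- by rewrite distrC [`|x - y|]distrC; exact: mixed.
- rewrite (bumps_out _ (Nx n))// (bumps_out _ (Ny n))// !add0r -(inv1_dist l0).
  exact: IH.
Qed.

Variables (c : nat -> R) (K : R).
Hypothesis K0 : 0 <= K.
Hypothesis c_le : forall n, `|c n| <= K * (l `^ (p%:R + a)) ^+ n.

Let level x := xget 0%N [set n | gapn l n x].

Definition phi k x := c (level x) * bumps (level x) k x.

Lemma phi_gap n k x : gapn l n x -> phi k x = c n * bumps n k x.
Proof.
move=> gx; rewrite /phi (_ : level x = n)//.
by apply: xget_unique => // m /(gapn_inj l0 l2 gx).
Qed.

Lemma phi_out k x : (k <= p)%N -> (forall n, ~ gapn l n x) -> phi k x = 0.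
Proof. by move=> kp gx; rewrite /phi bumps_out ?mulr0. Qed.

Lemma eq_phi k x y : (k <= p)%N -> (forall n, gapn l n x <-> gapn l n y) ->
  (forall n, bumps n k x = bumps n k y) -> phi k x = phi k y.
Proof.
move=> kp gxy bxy; have [[n gx]|gx] := pselect (exists n, gapn l n x).
  by rewrite (phi_gap _ gx) (phi_gap _ (iffLR (gxy n) gx)) bxy.
by rewrite !phi_out// => n gn; apply: gx; exists n => //; exact/gxy.
Qed.

Lemma phi_I01 k x : (k <= p)%N -> ~ I01 x -> phi k x = 0.
Proof.
move=> kp xI; apply: phi_out => // n /(gapn01 l0 l2)/andP[? ?]; apply: xI.
by rewrite I01E !ltW.
Qed.

(** The size l^(n (p + a)) of the coefficients absorbs the loss l^(-n (k + t)) caused by k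
    derivatives and a Hölder exponent t. *)
Lemma scale_le1 n k (t : R) : k%:R + t <= p%:R + a ->
  (l `^ (p%:R + a)) ^+ n * (l^-1 ^+ (n * k) * (l^-1 ^+ n) `^ t) <= 1.
Proof.
move=> kt; have ll0 := ltW l0; have ln0 := powR_ge0 l.
rewrite -!powR_inv1// -!powR_mulrn// -!powRrM -!powRD; first last.
- by rewrite (gt_eqF l0) implybT.
- by rewrite (gt_eqF l0) implybT.
rewrite -[leRHS](powRr0 l) ger_powR ?l0//=; first by slra.
rewrite natrM.
have -> : (p%:R + a) * n%:R + (-1 * (n%:R * k%:R) + -1 * (n%:R * t)) =
  n%:R * (p%:R + a - (k%:R + t)) by ring.
by rewrite mulr_ge0// subr_ge0.
Qed.

Lemma scaled_le n k (u B C t : R) : 0 <= C -> 0 <= B -> k%:R + t <= p%:R + a ->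
  `|u| <= B * l^-1 ^+ (n * k) * (l^-1 ^+ n * C) `^ t ->
  `|c n * u| <= K * B * C `^ t.
Proof.
move=> C0 B0 kt uB; have Ln : 0 <= l^-1 ^+ n by rewrite exprn_ge0// ltW.
rewrite normrM (le_trans (ler_pM _ _ (c_le n) uB))//.
rewrite powRM//.
have -> : K * l `^ (p%:R + a) ^+ n *
    (B * l^-1 ^+ (n * k) * ((l^-1 ^+ n) `^ t * C `^ t)) =
  K * B * C `^ t * (l `^ (p%:R + a) ^+ n * (l^-1 ^+ (n * k) * (l^-1 ^+ n) `^ t)).
  by ring.
by rewrite ler_piMr ?scale_le1// !mulr_ge0// powR_ge0.
Qed.

Lemma phi_decay n k x y (t : R) : (k <= p)%N -> 0 < t <= 2 ->
  k%:R + t <= p%:R + a -> gapn l n x -> ~ gapn l n y ->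
  `|phi k x| <= K * M * `|x - y| `^ t.
Proof.
move=> kp t02 kt gx gy; rewrite (phi_gap _ gx).
by apply: scaled_le kt _ => //; [exact: ltW|exact: bumps_decay].
Qed.

(** For points in gaps of different levels, each value is bounded by the distance to the other
    point, which lies outside the gaps of its level. *)
Lemma phi_holder x y : `|phi p x - phi p y| <= K * (2 * M) * `|x - y| `^ a.
Proof.
have a02 : 0 < a <= 2 by case/andP: a01 => -> /=; lra.
have KM0 : 0 <= K * M by rewrite mulr_ge0// ltW.
have half n u v : gapn l n u -> ~ gapn l n v ->
    `|phi p u| <= K * M * `|u - v| `^ a.
  by move=> gu gv; apply: phi_decay gv => //.
have KM2 (d : R) : K * (2 * M) * d `^ a = K * M * d `^ a + K * M * d `^ a by ring.
have main n u v : gapn l n u ->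
    `|phi p u - phi p v| <= K * (2 * M) * `|u - v| `^ a.
  move=> gu; have [gv|gv] := pselect (gapn l n v).
    rewrite (phi_gap _ gu) (phi_gap _ gv) -mulrBr.
    apply: (@scaled_le n p) => //; first by rewrite mulr_ge0// ltW.
    exact: bumps_holder.
  rewrite KM2 (le_trans (ler_normB _ _))// lerD//; first exact: half gv.
  have [[m gv']|gv'] := pselect (exists m, gapn l m v).
    rewrite distrC; apply: (half m) => // gu'.
    by apply: gv; rewrite (gapn_inj l0 l2 gu gu').
  rewrite phi_out ?normr0 ?mulr_ge0 ?powR_ge0 ?(ltW M0)//.
  by move=> m gm; apply: gv'; exists m.
have [[n gx]|gx] := pselect (exists n, gapn l n x); first exact: main gx.
have [[n gy]|gy] := pselect (exists n, gapn l n y).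
  by rewrite distrC [`|x - y|]distrC; exact: main gy.
rewrite !phi_out ?subrr ?normr0 ?KM2 ?addr_ge0 ?mulr_ge0 ?powR_ge0 ?(ltW M0)//.
- by move=> m gm; apply: gy; exists m.
- by move=> m gm; apply: gx; exists m.
Qed.

(** Inside a gap [phi] is locally one smooth term. At any other point it vanishes together with the
    candidate derivative, and the decay with t = 1 + a, available since k < p, is the remainder that
    [is_derive_little] wants. *)
Lemma is_derive_phi k x : (k < p)%N -> is_derive x 1 (phi k) (phi k.+1 x).
Proof.
move=> kp; have kp' := ltnW kp.
have [[n gx]|gx] := pselect (exists n, gapn l n x).
  rewrite (phi_gap _ gx).
  apply: (@near_eq_is_derive _ _ _ (c n *: bumps n k)).
    near=> y; rewrite (@phi_gap n)//.
    near: y; apply: (open_nbhs_nbhs (A := [set y | gapn l n y])).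
    by split; [exact: open_gapn|].
  exact: (is_derive_eq (is_deriveZ (c n) (is_derive_bumps n x kp))).
have gx' n : ~ gapn l n x by move=> g; apply: gx; exists n.
rewrite (phi_out kp gx').
apply: (@is_derive_little _ _ _ _ (K * M) a a0) => y.
rewrite (phi_out kp' gx') subr0 mul0r subr0.
have [[n gy]|gy] := pselect (exists n, gapn l n y).
  apply: (phi_decay kp' _ _ gy (gx' n)).
    by case/andP: a01 => *; lra.
  by rewrite addrA lerD2r natr1 ler_nat.
rewrite phi_out ?normr0 ?mulr_ge0 ?powR_ge0 ?(ltW M0)//.
by move=> m gm; apply: gy; exists m.
Unshelve. all: by end_near. Qed.

Lemma phi_smooth01 : smooth01 p a (phi 0).
Proof.
have main j k : (k + j = p)%N -> smooth01 j a (phi k).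
  elim: j k => [|j IH] k kj.
    exists (K * (2 * M)); first by rewrite !mulr_ge0// ltW.
    by rewrite addn0 in kj; rewrite kj => x y _ _; exact: phi_holder.
  exists (phi k.+1); last by apply: IH; rewrite addSnnS.
  by move=> x _; apply: is_derive_phi; rewrite -kj addnS ltnS leq_addr.
exact: main.
Qed.

Lemma phi_continuous : continuous (phi 0).
Proof.
move=> x; have [p0|p0] := posnP p; last first.
  by have [/derivable1_diffP/differentiable_continuous] := is_derive_phi x p0.
apply/cvgrPdist_le => e e0.
set C := K * (2 * M) + 1.
have C0 : 0 < C by rewrite ltr_wpDl// !mulr_ge0// ltW.
set d := (e / C) `^ a^-1.
have d0 : 0 < d by apply: powR_gt0; exact: divr_gt0.
near=> y.
have yd : `|x - y| < d by near: y; exists d.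
have := phi_holder x y; rewrite p0 => /le_trans; apply.
apply: (@le_trans _ _ (C * d `^ a)); last first.
  rewrite -powRrM mulVf ?gt_eqF// powRr1; last by rewrite ltW// divr_gt0.
  by rewrite mulrC divfK// gt_eqF.
apply: ler_pM; rewrite ?powR_ge0 ?lerDl// ?mulr_ge0 ?(ltW M0)//.
by apply: ge0_ler_powR; rewrite ?nnegrE ?(ltW a0)// ltW.
Unshelve. all: by end_near. Qed.

Lemma phi_bounded x : `|phi 0 x| <= K * M.
Proof.
have KM0 : 0 <= K * M by rewrite mulr_ge0// ltW.
have [[n gx]|gx] := pselect (exists n, gapn l n x); last first.
  rewrite phi_out ?normr0//.
  by move=> m gm; apply: gx; exists m.
have := gapn01 l0 l2 gx => /andP[x0 x1].
have g0 : ~ gapn l n 0 by move=> /(gapn01 l0 l2); rewrite ltxx.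
have a02 : 0 < a <= 2 by case/andP: a01 => -> /=; lra.
rewrite (le_trans (phi_decay (leq0n p) a02 _ gx g0)) ?add0r ?lerDr//.
by rewrite ler_piMr// powR_le1 ?(ltW a0)// normr_ge0 subr0 gtr0_norm// ltW.
Qed.

Let lX n x : I01 x -> I01 (l ^+ n * x).
Proof.
rewrite !I01E => /andP[x0 x1]; rewrite mulr_ge0 ?exprn_ge0 ?(ltW l0)//=.
by rewrite mulr_ile1 ?exprn_ge0 ?exprn_ile1 ?(ltW l0)//; slra.
Qed.

Let lI0 x : I01 x -> I01 (l * x).
Proof. by move/(lX 1). Qed.

Let lI1 x : I01 x -> I01 (1 - l + l * x).
Proof.
move=> xI; have := lI0 xI; rewrite !I01E; case/andP=> ? ?.
by move: xI; rewrite I01E => /andP[x0 x1]; have := ler_pM2l l0 x 1; rewrite x1 mulr1; slra.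
Qed.

Lemma bumps_lM n x : I01 x -> bumps n.+1 0 (l * x) = bumps n 0 x.
Proof.
move=> x01; rewrite /= expr0 mul1r.
rewrite [X in _ + X]bumps_out ?addr0//.
  by rewrite /inv0 mulrC mulKf// gt_eqF.
move=> g; have : gapn l 0 (l * x) \/ gapn l n.+1 (l * x) by right; right.
move=> [] /(gapn_lM l0 l2 _ x01)[m]//.
move: g => /(gapn01 l0 l2)/andP[+ _] _ _.
rewrite /inv1 ltr_pdivlMr// mul0r; move: x01; rewrite I01E => /andP[x0 x1].
have := ler_pM2l l0 x 1; rewrite x1 mulr1; slra.
Qed.

Lemma bumps_lMD n x : I01 x -> bumps n.+1 0 (1 - l + l * x) = bumps n 0 x.
Proof.
move=> x01; rewrite /= expr0 mul1r.
rewrite [X in X + _]bumps_out ?add0r//.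
  by rewrite /inv1 addrAC subrr add0r mulrC mulKf// gt_eqF.
move=> /(gapn01 l0 l2)/andP[_]; rewrite /inv0 ltr_pdivrMr// mul1r.
move: x01; rewrite I01E => /andP[x0 x1].
have lx : 0 <= l * x by rewrite mulr_ge0// ltW.
by slra.
Qed.

(** The coefficients depend on the level only, so [phi] looks the same on the two children of the
    cylinder [0, l^n]. Hence its primitive on one child is a constant plus that on the other, which
    makes the Fourier transform factor. *)
Lemma phi_translate n x : I01 x ->
  phi 0 (l ^+ n * (1 - l + l * x)) = phi 0 (l ^+ n * (l * x)).
Proof.
move=> x01; apply: eq_phi => // m.
  elim: n m => [|n IH] m.
    rewrite !expr0 !mul1r; split.
      by move=> /(gapn_lMD l0 l2 _ x01)/(gapn_lM l0 l2 _ x01).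
    by move=> /(gapn_lM l0 l2 _ x01)/(gapn_lMD l0 l2 _ x01).
  rewrite !exprS -!mulrA; split.
    move=> /(gapn_lM l0 l2 _ (lX n (lI1 x01)))[q mq /IH gq].
    by apply/(gapn_lM l0 l2 _ (lX n (lI0 x01))); exists q.
  move=> /(gapn_lM l0 l2 _ (lX n (lI0 x01)))[q mq /IH gq].
  by apply/(gapn_lM l0 l2 _ (lX n (lI1 x01))); exists q.
elim: n m => [|n IH] [|m].
- rewrite !expr0 !mul1r !bumps_out//.
  + by move=> /(gapn_lM l0 l2 _ x01)[].
  + by move=> /(gapn_lMD l0 l2 _ x01)[].
- by rewrite !expr0 !mul1r bumps_lM// bumps_lMD.
- rewrite !exprS -!mulrA !bumps_out//.
  + by move=> /(gapn_lM l0 l2 _ (lX n (lI0 x01)))[].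
  + by move=> /(gapn_lM l0 l2 _ (lX n (lI1 x01)))[].
- rewrite !exprS -!mulrA !bumps_lM//; first exact: lX (lI0 x01).
  exact: lX (lI1 x01).
Qed.

Lemma phi_gap0 n x : gap l x -> phi 0 (l ^+ n * x) = c n * b 0 x.
Proof.
move=> gx; have xI : I01 x.
  by move: gx => /(@gapn01 _ l l0 l2 0); rewrite I01E => /andP[? ?]; rewrite !ltW.
have gn : gapn l n (l ^+ n * x).
  elim: n => [|n IH]; first by rewrite expr0 mul1r.
  by rewrite exprS -mulrA; apply/(gapn_lM l0 l2 _ (lX n xI)); exists n.
rewrite (phi_gap _ gn); congr (_ * _).
elim: n {gn} => [|n IH]; first by rewrite expr0 mul1r.
by rewrite exprS -mulrA bumps_lM//; exact: lX.
Qed.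

End bump_series.

(** * A primitive with prescribed displacements *)

Lemma geometric_tails (R : realType) (d : nat -> R) (K q : R) :
  0 <= K -> 0 < q <= 1 / 2 -> (forall n, `|d n| <= K * q ^+ n) ->
  exists S : nat -> R, (forall n, S n = d n + S n.+1) /\
    (forall n, `|S n| <= 2 * K * q ^+ n).
Proof.
move=> K0 /andP[q0 q2] dK.
pose u n k := d (n + k)%N.
have q1 : `|q| < 1 by rewrite gtr0_norm//; lra.
have uK n k : `|u n k| <= geometric (K * q ^+ n) q k.
  by rewrite /= -mulrA -exprD; exact: dK.
have nc n : cvgn [normed series (u n)].
  apply: (series_le_cvg _ _ (uK n)) => //; last exact: is_cvg_geometric_series.
  by move=> k; rewrite (le_trans _ (uK n k)).
exists (fun n => limn (series (u n))); split=> n.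
  have E : (fun k => d n + series (u n.+1) k) = (fun k => series (u n) k.+1).
    apply/funext => k /=; rewrite !seriesEnat/= big_nat_recl// /u addn0.
    by congr (_ + _); apply: eq_bigr => i _; rewrite addnS addSn.
  have H : d n + series (u n.+1) k @[k --> \oo] --> d n + limn (series (u n.+1)).
    by apply: cvgD; [exact: cvg_cst|exact: normed_cvg].
  by apply/cvg_lim => //; rewrite -cvg_shiftS; rewrite E in H.
rewrite (le_trans (lim_series_norm (nc n)))//.
rewrite (le_trans (lim_series_le (nc n) (is_cvg_geometric_series q1) (uK n)))//.
rewrite (cvg_lim _ (cvg_geometric_series q1))//.
rewrite ler_pdivrMr ?subr_gt0; last by lra.
rewrite -!mulrA [q ^+ n * _]mulrC !mulrA ler_wpM2r ?exprn_ge0 ?(ltW q0)//.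
by rewrite [2 * K]mulrC -mulrA ler_peMr//; lra.
Qed.

Lemma derivative_eq0_cst (R : realType) (f f' : R -> R) :
  (forall x : R, I01 x -> is_derive x 1 f (f' x)) ->
  (forall x, I01 x -> f' x = 0) ->
  forall x y, I01 x -> I01 y -> f x = f y.
Proof.
move=> ff' f'0 x y x01 y01; apply/eqP; rewrite -subr_eq0 -normr_le0.
rewrite -(mul0r `|x - y|).
by apply: (derivative_bounded_lipschitz ff' _ x01 y01) => z /f'0 ->; rewrite normr0.
Qed.

Lemma is_derive_comp_affine (R : realType) (f : R -> R) (df u v x : R) :
  is_derive (u * x + v) 1 f df ->
  is_derive x 1 (fun y => f (u * y + v)) (u * df).
Proof.
move=> fdf; have da := is_deriveD (is_deriveZ u (is_derive_id x 1)) (is_derive_cst v x 1).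
have := is_derive1_comp (f := f) (g := u *: id + cst v) fdf da.
by move=> H; apply: (is_derive_eq H); rewrite addr0 /GRing.scale/= mulr1 mulrC.
Qed.

Section prescribed_increments.
Context {R : realType} (l : R).
Hypotheses (l0 : 0 < l) (l2 : l < 1 / 2).
Variables (p : nat) (a : R).
Hypothesis a01 : 0 < a <= 1.
Ltac slra := move: (l0) (l2) => ? ?; lra.

(* The jump of G - id across a gap of level n is d n - (d n.+1 + d n.+2 + ...),
   so that passing from the left to the right branch at level n costs d n,
   whatever the deeper digits are. *)
Lemma prescribed_increments : exists2 e : R, 0 < e &
  forall d : nat -> R, (forall n, `|d n| <= e * (l `^ (p%:R + 1 + a)) ^+ n) ->
  exists G psi : R -> R,
  [/\ forall x : R, is_derive x 1 G (psi x),
      (forall x, 2 / 3 <= psi x <= 4 / 3) /\ continuous psi,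
      smooth01 p a psi,
      forall x, (forall n, ~ gapn l n x) -> psi x = 1 &
      G 0 = 0 /\ forall n x, I01 x ->
        G (l ^+ n * (1 - l + l * x)) =
        G (l ^+ n * (l * x)) + (l ^+ n * (1 - l) + d n)].
Proof.
have l012 : 0 < l < 1 / 2 by rewrite l0.
have [b [M [M0 [bc [bD bo bd bl bp]]]]] := bump_family p l012.
have gI x : gap l x -> I01 x by rewrite /gap/= I01E => /andP[? ?]; slra.
have [B BD] : exists B : R -> R, forall x : R, is_derive x 1 B (b 0%N x).
  by apply: antiderivative => // x xI; apply: bo => // /gI.
pose beta := B (1 - l) - B l.
have ll : l < 1 - l by slra.
have beta0 : 0 < beta.
  have Bc : {within `[l, 1 - l], continuous B}.
    by apply: derivable_within_continuous => x _; case: (BD x).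
  have [c cl] := MVT ll (fun x _ => BD x) Bc.
  rewrite /beta => ->; rewrite mulr_gt0 ?subr_gt0//; apply: bp.
  by move: cl; rewrite in_itv.
(* With K = 2 e / beta below, this gives K * M = 1 / 3, the bound on psi - 1. *)
exists (beta / (6 * M)); first by rewrite divr_gt0// mulr_gt0.
set e := beta / (6 * M) => d dq; set q := l `^ (p%:R + 1 + a) in dq.
have /andP[a0 a1] := a01.
have e0 : 0 < e by rewrite divr_gt0// mulr_gt0.
have q0 : 0 < q by rewrite powR_gt0.
have ql : q = l * l `^ (p%:R + a).
  by rewrite /q -addrA [1 + a]addrC addrA powRD ?(gt_eqF l0) ?implybT// powRr1 ?(ltW l0)// mulrC.
have qlel : q <= l.
  rewrite ql -[leRHS]mulr1 ler_pM2l// -[leRHS](powRr0 l) ger_powR ?l0 ?addr_ge0 ?(ltW a0)//.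
  by slra.
have q12 : 0 < q <= 1 / 2 by rewrite q0/=; slra.
have [S [SE SK]] := geometric_tails (ltW e0) q12 dq.
(* A gap of level n is a copy of the middle gap scaled by l^n, so [phi] integrates over it to c n *
   l^n * beta. This is set equal to the wanted jump, [S n.+1] being the tail d n.+1 + d n.+2 +
   ... *)
pose c n := (d n - S n.+1) / (l ^+ n * beta).
pose K := 2 * e / beta.
have K0 : 0 <= K by apply: divr_ge0; [rewrite mulr_ge0// ltW|exact: ltW].
have cK n : `|c n| <= K * (l `^ (p%:R + a)) ^+ n.
  have ln : 0 < l ^+ n by rewrite exprn_gt0.
  rewrite normrM normfV (gtr0_norm (mulr_gt0 ln beta0)) ler_pdivrMr ?mulr_gt0//.
  have -> : K * l `^ (p%:R + a) ^+ n * (l ^+ n * beta) = 2 * e * q ^+ n.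
    by rewrite /K ql exprMn; field; rewrite gt_eqF.
  rewrite (le_trans (ler_normB _ _))//.
  apply: (@le_trans _ _ (e * q ^+ n + 2 * e * q ^+ n.+1)); first by rewrite lerD.
  have qn : q ^+ n.+1 <= q ^+ n * (1 / 2).
    by rewrite exprSr ler_pM2l ?exprn_gt0//; slra.
  have : e * q ^+ n.+1 <= e * (q ^+ n * (1 / 2)) by rewrite ler_pM2l.
  by rewrite -mulrA; lra.
pose ph := phi l b c; have phE := @phi_gap R l l0 l2 b c.
have KM : K * M = 1 / 3.
  by rewrite /K /e; field; rewrite !gt_eqF.
have phb x : `|ph 0%N x| <= 1 / 3.
  by rewrite -KM; exact: (phi_bounded l0 l2 a01 M0 bo bd K0 cK).
have phc : continuous (ph 0%N).
  exact: (phi_continuous l0 l2 a01 M0 bD bo bd bl K0 cK).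
have [P0 P0D] : exists F : R -> R, forall x : R, is_derive x 1 F (ph 0%N x).
  by apply: antiderivative => // x; apply: (phi_I01 l0 l2 bo).
pose P x := P0 x - P0 0.
have PD (x : R) : is_derive x 1 P (ph 0%N x).
  apply: (is_derive_eq (is_deriveB (P0D x) (is_derive_cst (P0 0) x 1))).
  by rewrite subr0.
have P00 : P 0 = 0 by rewrite /P subrr.
have lX n x : I01 x -> I01 (l ^+ n * x).
  rewrite !I01E => /andP[x0 x1]; rewrite mulr_ge0 ?exprn_ge0 ?(ltW l0)//=.
  by rewrite mulr_ile1 ?exprn_ge0 ?exprn_ile1 ?(ltW l0)//; slra.
have Pstep n x : I01 x -> P (l ^+ n * (1 - l + l * x)) - P (l ^+ n * (l * x)) =
    P (l ^+ n * (1 - l)).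
  move=> x01; pose D y := P (l ^+ n * l * y + l ^+ n * (1 - l)) -
    P (l ^+ n * l * y + 0).
  have DD (y : R) : is_derive y 1 D (l ^+ n * l * (ph 0%N (l ^+ n * l * y + l ^+ n * (1 - l)) -
      ph 0%N (l ^+ n * l * y + 0))).
    rewrite mulrBr; apply: is_deriveB; exact: is_derive_comp_affine.
  have := derivative_eq0_cst (fun y _ => DD y) _ x01 I01_0.
  have -> : D x = P (l ^+ n * (1 - l + l * x)) - P (l ^+ n * (l * x)).
    by rewrite /D; congr (P _ - P _); ring.
  have -> : D 0 = P (l ^+ n * (1 - l)).
    by rewrite /D !mulr0 !add0r P00 subr0.
  apply=> y y01; rewrite addr0.
  have -> : l ^+ n * l * y + l ^+ n * (1 - l) = l ^+ n * (1 - l + l * y) by ring.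
  by rewrite -[l ^+ n * l * y]mulrA /ph (phi_translate l0 l2 bo c n y01) subrr mulr0.
pose I n := P (l ^+ n).
have PI n : P (l ^+ n * (1 - l)) = I n - I n.+1.
  rewrite -(Pstep n 1 I01_1) mulr1 subrK mulr1 /I.
  by rewrite exprSr.
have Pjump n : P (l ^+ n * (1 - l)) - I n.+1 = c n * l ^+ n * beta.
  pose D y := P (l ^+ n * y + 0) - (l ^+ n * c n) * B y.
  have DD (y : R) : is_derive y 1 D (l ^+ n * ph 0%N (l ^+ n * y + 0) - (l ^+ n * c n) * b 0%N y).
    by apply: is_deriveB; exact: is_derive_comp_affine.
  have Dc : {within `[l, 1 - l], continuous D}.
    by apply: derivable_within_continuous => x _; case: (DD x).
  have [x xl] := MVT ll (fun x _ => DD x) Dc.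
  have gx : gap l x by move: xl; rewrite in_itv.
  rewrite addr0 /ph (phi_gap0 l0 l2 bo c n gx) mulrA subrr mul0r /D !addr0.
  rewrite /I exprSr /beta; lra.
(* [0, l^n] consists of two children of equal integral [I n.+1] and the gap between them. By the
   choice of [c], the tails [S] obey the same recursion. *)
have IE n : I n = 2 * I n.+1 + c n * l ^+ n * beta.
  by have := Pjump n; rewrite PI; lra.
have SE' n : S n = 2 * S n.+1 + c n * l ^+ n * beta.
  rewrite -mulrA /c divfK; first by rewrite [LHS]SE; ring.
  by rewrite gt_eqF// mulr_gt0// exprn_gt0.
(* The common recursion gives E 0 = 2^n E n, while [I] and [S] are O(l^n). As 2 l < 1, the
   difference must vanish. *)
pose E n := I n - S n.
have EE n : E 0%N = 2 ^+ n * E n.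
  elim: n => [|n ->]; first by rewrite expr0 mul1r.
  by rewrite exprSr -mulrA; congr (_ * _); rewrite /E IE SE'; ring.
have ln01 n : I01 (l ^+ n) by rewrite -[l ^+ n]mulr1; apply: lX; exact: I01_1.
have Ib n : `|I n| <= 1 / 3 * l ^+ n.
  have := derivative_bounded_lipschitz (fun x _ => PD x) (fun x _ => phb x) (ln01 n) I01_0.
  by rewrite P00 !subr0 (ger0_norm (exprn_ge0 n (ltW l0))).
have qn n : q ^+ n <= l ^+ n by apply: lerXn2r => //; rewrite nnegrE ltW.
have Eb n : `|E n| <= (1 / 3 + 2 * e) * l ^+ n.
  rewrite (le_trans (ler_normB _ _))// mulrDl lerD// (le_trans (SK n))//.
  by rewrite ler_wpM2l ?qn// mulr_ge0// ltW.
have E0 : E 0%N = 0.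
  apply/eqP; rewrite -normr_le0.
  have l21 : `|2 * l| < 1 by rewrite gtr0_norm ?mulr_gt0//; slra.
  have cv := @cvg_geometric R (1 / 3 + 2 * e) _ l21.
  rewrite -(cvg_lim _ cv)//; apply: limr_ge; first by apply/cvg_ex; exists 0.
  near=> n; rewrite (EE n) normrM ger0_norm ?exprn_ge0//= exprMn mulrCA.
  by rewrite ler_wpM2l ?exprn_ge0.
have En n : I n = S n.
  apply/eqP; rewrite -subr_eq0; have /eqP := EE n.
  rewrite E0 eq_sym mulf_eq0 expf_eq0 pnatr_eq0 andbF//.
exists (fun x => x + P x), (fun x => 1 + ph 0%N x); split.
- move=> x; exact: (is_deriveD (is_derive_id x 1) (PD x)).
- split; first by move=> x; have := phb x; rewrite ler_norml => /andP[? ?]; lra.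
  by move=> x; apply: cvgD; [exact: cvg_cst|exact: phc].
- apply: smooth01D; first exact: smooth01_cst.
  exact: (phi_smooth01 l0 l2 a01 M0 bD bo bd bl K0 cK).
- by move=> x gx; rewrite /ph (phi_out bo)// addr0.
- split; first by rewrite add0r.
  move=> n x x01; have /eqP := Pstep n x x01.
  rewrite subr_eq => /eqP ->; rewrite PI !En [S n]SE.
  by ring.
Unshelve. all: by end_near. Qed.

End prescribed_increments.

(** * Normalization to a diffeomorphism and self-conformality *)

Section conjugation.
Context {R : realType}.

(** Working on the whole line makes the inverse differentiable in the two-sided sense at 0 and 1 as
    well, as [smooth01] requires. *)
Lemma global_inverse (f f' : R -> R) (c : R) : 0 < c ->
  (forall x : R, is_derive x 1 f (f' x)) -> (forall x, c <= f' x) ->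
  exists h : R -> R, [/\ cancel f h, cancel h f &
    forall y : R, is_derive y 1 h (f' (h y))^-1].
Proof.
move=> c0 ff' cf'.
have fc : continuous f.
  by move=> x; apply/differentiable_continuous/derivable1_diffP; case: (ff' x).
have grow x y : x <= y -> c * (y - x) <= f y - f x.
  move=> xy; have [z _ ->] := MVT_segment xy (fun z _ => ff' z)
    (derivable_within_continuous (fun z _ => @ex_derive _ _ _ _ _ _ _ (ff' z))).
  by rewrite ler_wpM2r ?subr_ge0.
have inj : injective f.
  move=> x y; wlog xy : x y / x <= y.
    by move=> W fxy; case: (leP x y) => [|/ltW] /W ->.
  move=> fxy; have := grow _ _ xy; rewrite fxy subrr pmulr_rle0// subr_le0.
  by move=> yx; apply/eqP; rewrite eq_le xy.
have surj y : exists x, f x = y.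
  pose N := `|y - f 0| / c.
  have N0 : 0 <= N by rewrite divr_ge0// ltW.
  have cN : c * N = `|y - f 0| by rewrite mulrC divfK// gt_eqF.
  have NN : - N <= N by rewrite (le_trans _ N0)// oppr_le0.
  have fN : y <= f N.
    have := grow _ _ N0; rewrite subr0 cN; have := ler_norm (y - f 0); lra.
  have fNN : f (- N) <= y.
    have := @grow (- N) 0; rewrite oppr_le0 sub0r opprK cN => /(_ N0).
    have := ler_norm (f 0 - y); rewrite distrC; lra.
  have [||x _ xy] := @IVT R f (- N) N y NN; last by exists x.
    exact: continuous_subspaceT.
  by rewrite (min_idPl (le_trans fNN fN)) (max_idPr (le_trans fNN fN)) fNN.
pose h y := xget 0 [set x | f x = y].
have fh : cancel h f.
  by move=> y; have [x xy] := surj y; rewrite /h; case: xgetP => // /(_ x).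
have hf : cancel f h by move=> x; apply: inj; rewrite fh.
exists h; split=> // y; rewrite -[y in is_derive y]fh.
apply: is_derive_inverse => //.
- by near=> x; exact: hf.
- by near=> x; exact: fc.
- by rewrite gt_eqF// (lt_le_trans c0).
Unshelve. all: by end_near. Qed.

Lemma continuous_mfun (f : R -> R) : continuous f ->
  exists F : {mfun measurableTypeR R >-> measurableTypeR R}, F = f :> (R -> R).
Proof.
move=> /continuous_measurable_fun mf.
have fP : (f : measurableTypeR R -> measurableTypeR R) \in mfun by rewrite inE.
by exists (mfun_Sub fP); rewrite mfun_valP.
Qed.

Lemma derivative_ge0_nondecreasing (f f' : R -> R) :
  (forall x : R, is_derive x 1 f (f' x)) -> (forall x, 0 <= f' x) ->
  {homo f : x y / x <= y}.
Proof.
move=> ff' f'0 x y xy; rewrite -subr_ge0.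
have [z _ ->] := MVT_segment xy (fun z _ => ff' z)
  (derivable_within_continuous (fun z _ => @ex_derive _ _ _ _ _ _ _ (ff' z))).
by rewrite mulr_ge0 ?subr_ge0.
Qed.

Lemma derive_continuous (f f' : R -> R) :
  (forall x : R, is_derive x 1 f (f' x)) -> continuous f.
Proof.
by move=> ff' x; apply/differentiable_continuous/derivable1_diffP; case: (ff' x).
Qed.

(** Division by G 1 makes g fix 0 and 1. The maps of the system are g o e_i o h with h the inverse
    of g; their derivative l psi (e_i (h x)) / psi (h x) has a numerator below 2/3 and a denominator
    of at least 2/3. A common fixed point would pull back to one of [e0] and [e1], whose only fixed
    points are 0 and 1 respectively. *)
Lemma normalized_conjugation (l a : R) (p : nat) (G psi : R -> R)
    (mu : probability (measurableTypeR R) R) :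
  0 < l -> l < 1 / 2 -> 0 < a <= 1 -> bernoulli_convolution l mu ->
  (forall x : R, is_derive x 1 G (psi x)) ->
  (forall x, 2 / 3 <= psi x <= 4 / 3) -> continuous psi ->
  smooth01 p a psi -> G 0 = 0 ->
  exists (g : {mfun measurableTypeR R >-> measurableTypeR R}) (eta : R),
  [/\ 0 < eta, forall x, g x = eta * G x, diffeo01 p.+1 a g,
      self_conformal (distribution mu g) &
      forall x, I01 x -> psi x = 1 -> deriv01 g x = eta].
Proof.
move=> l0 l2 a01 [muI muE] GD psib psic psis G0.
have /andP[a0 _] := a01.
have G1 : 0 < G 1.
  have [z _] := MVT_segment ler01 (fun z _ => GD z)
    (derivable_within_continuous (fun z _ => @ex_derive _ _ _ _ _ _ _ (GD z))).
  rewrite G0 !subr0 mulr1 => ->.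
  by have /andP[? ?] := psib z; lra.
pose eta := (G 1)^-1; have eta0 : 0 < eta by rewrite invr_gt0.
pose g x := eta * G x; pose g' x := eta * psi x.
have gD (x : R) : is_derive x 1 g (g' x) by exact: (is_deriveZ eta (GD x)).
have c0 : 0 < eta * (2 / 3) by rewrite mulr_gt0.
have cg' x : eta * (2 / 3) <= g' x.
  by rewrite ler_pM2l//; case/andP: (psib x).
have g'0 x : 0 < g' x by exact: lt_le_trans (cg' x).
have [h [gh hg hD]] := global_inverse c0 gD cg'.
have gmono := derivative_ge0_nondecreasing gD (fun x => ltW (g'0 x)).
have hmono : {homo h : x y / x <= y}.
  by apply: (derivative_ge0_nondecreasing hD) => x; rewrite invr_ge0 ltW.
have g00 : g 0 = 0 by rewrite /g G0 mulr0.
have g11 : g 1 = 1 by rewrite /g mulVf ?gt_eqF.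
have h00 : h 0 = 0 by rewrite -[in LHS]g00 gh.
have h11 : h 1 = 1 by rewrite -[in LHS]g11 gh.
have I01_homo (k : R -> R) : {homo k : x y / x <= y} -> k 0 = 0 -> k 1 = 1 ->
    forall x, I01 x -> I01 (k x).
  move=> kmono k0 k1 x; rewrite !I01E => /andP[x0 x1].
  by rewrite -[leLHS]k0 -[X in _ && (_ <= X)]k1 !kmono.
have gI := I01_homo _ gmono g00 g11; have hI := I01_homo _ hmono h00 h11.
have g's : smooth01 p a g' by apply: smooth01M => //; exact: smooth01_cst.
have gs : smooth01 p.+1 a g by exists g'.
have hs : smooth01 p.+1 a h.
  exact: (smooth01_inverse a01 c0 (fun x _ => gD x) (fun x _ => cg' x) g's hI).
have gc := derive_continuous gD; have hc := derive_continuous hD.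
have [F FE] := continuous_mfun gc.
exists F, eta; rewrite FE; split=> //.
- split; first split.
  + exact: gI.
  + by move=> x y _ _ gxy; rewrite -(gh x) gxy gh.
  + by move=> y yI; exists (h y); [exact: hI|exact: hg].
  + exact: smooth01_Cralpha01.
  + exists h; split=> //; exact: smooth01_Cralpha01.
- pose e (i : 'I_2) x : R := if i == ord0 then e0 l x else e1 l x.
  have eA i x : e i x = l * x + (if i == ord0 then 0 else 1 - l).
    by rewrite /e /e0 /e1; case: ifP => _; rewrite ?addr0// addrA.
  have eD i (x : R) : is_derive x 1 (e i) l.
    have -> : e i = (fun x => id (l * x + (if i == ord0 then 0 else 1 - l))).
      by apply/funext => y; rewrite eA.
    by have := is_derive_comp_affine (f := id) (u := l) (is_derive_id (l * x + _) 1); rewrite mulr1.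
  pose f i := g \o e i \o h.
  pose f' i x := g' (e i (h x)) * l * (g' (h x))^-1.
  have fD i (x : R) : is_derive x 1 (f i) (f' i x).
    apply: is_derive1_comp (hD x).
  have [Fi FiE] := choice (fun i => continuous_mfun (derive_continuous (fD i))).
  have eI i x : I01 x -> I01 (e i x).
    rewrite eA !I01E => /andP[x0 x1].
    have lx0 : 0 <= l * x by rewrite mulr_ge0// ltW.
    have lx1 : l * x <= l by rewrite ler_piMr// ltW.
    by case: ifP => _; lra.
  have hK := smooth01_lipschitz a0 hs.
  have fs i : smooth01 p.+1 a (f i).
    have es : smooth01 p.+1 a (e i \o h).
      have [K K0 hKK] := hK.
      apply: (smooth01_comp a01 hI K0 hKK _ hs).
      have -> : e i = (fun x => l * x + (if i == ord0 then 0 else 1 - l)).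
        by apply/funext => y; rewrite eA.
      exact: smooth01_affine.
    have [K K0 eK] := smooth01_lipschitz a0 es.
    apply: (smooth01_comp a01 _ K0 eK gs es) => x xI /=.
    exact/eI/hI.
  have fg i x : f i (g x) = g (e i x) by rewrite /f /= gh.
  split.
    have gI01 : g @^-1` I01 = I01.
      by apply/seteqP; split=> x; [move=> /hI; rewrite gh|exact: gI].
    change (mu (F @^-1` I01) = 1%E); rewrite FE.
    by rewrite [X in mu X]gI01.
  exists 2%N, Fi, (fun=> 2^-1); split.
  + move=> i; rewrite FiE; split.
    * by move=> x xI; exact/gI/eI/hI.
    * have [[fd fc] _] := smooth01_Cralpha01 a01 (fs i).
      by split=> k k1; [apply: fd|apply: fc]; rewrite (leq_trans k1).
    * move=> x; rewrite inE => xI.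
      have [_ ->] := deriv01_is_derive xI (fun _ _ => erefl) (fD i x).
      have f'0 : 0 < f' i x by rewrite /f' divr_gt0// mulr_gt0.
      rewrite gtr0_norm// f'0/= /f' ltr_pdivrMr// mul1r /g'.
      rewrite -mulrA ltr_pM2l//.
      have /andP[p1 p2] := psib (e i (h x)); have /andP[p3 p4] := psib (h x).
      have : psi (e i (h x)) * l < psi (e i (h x)) * (1 / 2) by rewrite ltr_pM2l//; lra.
      by lra.
  + move=> [x xI fx]; have hfx i : e i (h x) = h x.
      by have := fx i; rewrite FiE => fix_; rewrite -{2}fix_ /f /= gh.
    have := hfx ord0; have := hfx ord_max; rewrite !eA /= => e1 e0.
    have h1 : (1 - l) * h x = 0 by lra.
    have h2 : (1 - l) * (1 - h x) = 0 by lra.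
    by lra.
  + by split=> [i|]; rewrite ?invr_gt0// !big_ord_recl big_ord0; lra.
  + move=> A mA; rewrite /distribution/= {1}/pushforward/=.
    have mFA : measurable (F @^-1` A) by rewrite -[_ @^-1` _]setTI; exact: measurable_funP.
    change (mu (F @^-1` A) =
      \sum_(i < 2) (2^-1)%:E * mu (F @^-1` (Fi i @^-1` A)))%E.
    rewrite (muE _ mFA) !big_ord_recl big_ord0 adde0 !FiE FE.
    rewrite /pushforward; congr (_ * mu _ + _ * mu _)%E; apply/funext => x.
      by rewrite /preimage/= fg.
    by rewrite /preimage/= fg.
- move=> x xI px; have [_ ->] := deriv01_is_derive xI (fun _ _ => erefl) (gD x).
  by rewrite /g' px mulr1.
Qed.

End conjugation.

(** * Fourier transforms of image measures *)

Section fourier_product.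
Context {R : realType}.
Local Notation borelR := (measurableTypeR R).
Implicit Types (f : R -> R) (P : probability borelR R).

Lemma bounded_continuous_integrable P f (C : R) : continuous f ->
  (forall x, `|f x| <= C) -> P.-integrable setT (EFin \o f).
Proof.
move=> fc fC; apply: measurable_bounded_integrable => //.
- by rewrite (le_lt_trans (probability_le1 P measurableT))// ltry.
- exact: continuous_measurable_fun.
- by exists C; split; [exact: num_real|move=> M CM x _; exact: le_trans (fC x) (ltW CM)].
Qed.

Lemma Rintegral_distribution P (g : {mfun borelR >-> borelR}) f (C : R) :
  continuous f -> (forall x, `|f x| <= C) -> continuous (g : R -> R) ->
  \int[distribution P g]_x f x = \int[P]_x f (g x).
Proof.
move=> fc fC gc; rewrite /Rintegral integral_distribution//.
- by apply/measurable_EFinP; exact: continuous_measurable_fun.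
- apply: (@bounded_continuous_integrable _ (f \o g) C) => [x|x]; last exact: fC.
  by apply: continuous_comp; [exact: gc|exact: fc].
Qed.

Lemma measure_setC_I01 P : on_unit_interval P -> P (~` I01) = 0%E.
Proof.
move=> PI; have mI : measurable (I01 : set borelR) by exact: measurable_itv.
by rewrite probability_setC// PI subee.
Qed.

Lemma Rintegral_I01 P f (C : R) : on_unit_interval P -> continuous f ->
  (forall x, `|f x| <= C) -> \int[P]_x f x = \int[P]_(x in I01) f x.
Proof.
move=> PI fc fC; rewrite /Rintegral.
have mI : measurable (I01 : set borelR) by exact: measurable_itv.
have := @negligible_integral _ borelR R P setT (~` I01) (EFin \o f)
  (measurableC mI) measurableT (bounded_continuous_integrable P fc fC)
  (measure_setC_I01 PI).
by rewrite setTD setCK => <-.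
Qed.

Lemma Rintegral_le_I01 P f (C K : R) : on_unit_interval P -> continuous f ->
  (forall x, `|f x| <= C) -> (forall x, I01 x -> `|f x| <= K) ->
  `|\int[P]_x f x| <= K.
Proof.
move=> PI fc fC fK; rewrite (Rintegral_I01 PI fc fC).
have mI : measurable (I01 : set borelR) by exact: measurable_itv.
have fi : P.-integrable I01 (EFin \o f).
  apply: (@integrableS _ _ _ _ setT) => //.
  exact: bounded_continuous_integrable fC.
rewrite (le_trans (le_normr_Rintegral mI fi))//.
have -> : K = \int[P]_(x in I01) (fun=> K) x.
  transitivity (K * fine (P I01)); first by rewrite PI mulr1.
  by rewrite Rintegral_cst.
apply: le_Rintegral => //; first exact: integrable_norm.
exact: finite_measure_integrable_cst.
Qed.

(** Doubling removes the factors 1/2: mu + mu is the sum of the two image measures, and integrals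
    add over [measure_add]. *)
Lemma bernoulli_Rintegral (l : R) (mu : probability borelR R) f (C : R) :
  bernoulli_convolution l mu -> continuous f -> (forall x, `|f x| <= C) ->
  \int[mu]_x f x + \int[mu]_x f x =
  \int[mu]_x f (l * x) + \int[mu]_x f (l * x + 1 - l).
Proof.
move=> [muI muE] fc fC.
have e0c : continuous (fun x : R => l * x) by exact: mulrl_continuous.
have e1c : continuous (fun x : R => l * x + 1 - l).
  move=> x; apply: cvgB; last exact: cvg_cst.
  by apply: cvgD; [exact: e0c|exact: cvg_cst].
have [E0 E0E] := continuous_mfun e0c; have [E1 E1E] := continuous_mfun e1c.
have fi (P : probability borelR R) : P.-integrable setT (EFin \o f).
  exact: bounded_continuous_integrable fC.
have -> : \int[mu]_x f (l * x) = \int[distribution mu E0]_x f x.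
  by rewrite (Rintegral_distribution _ fc fC) ?E0E.
have -> : \int[mu]_x f (l * x + 1 - l) = \int[distribution mu E1]_x f x.
  by rewrite (Rintegral_distribution _ fc fC) ?E1E.
have fin (P : probability borelR R) : (\int[P]_x (f x)%:E)%E \is a fin_num.
  exact: integrable_fin_num (fi P).
have sumE (P Q : probability borelR R) : \int[P]_x f x + \int[Q]_x f x =
    fine (\int[measure_add P Q]_x (f x)%:E)%E.
  rewrite (integral_measure_add measurableT (fi P) (fi Q)).
  by rewrite fineD//; exact: fin.
rewrite !sumE; congr fine; apply: eq_measure_integral => A mA _.
rewrite /measure_add/= /msum !big_ord_recl !big_ord0 !adde0/=.
change (mu A + mu A = mu (E0 @^-1` A) + mu (E1 @^-1` A))%E.
have half (x : \bar R) : ((2^-1)%:E * x + (2^-1)%:E * x = x)%E.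
  by rewrite -ge0_muleDl// -EFinD (_ : 2^-1 + 2^-1 = 1) ?mul1e//; lra.
rewrite (muE _ mA) E0E E1E /pushforward addeACA !half.
by [].
Qed.

(* The squared modulus of the integral of exp (i T). *)
Definition sqnorm_exp (mu : probability borelR R) (T : R -> R) : R :=
  (\int[mu]_x cos (T x)) ^+ 2 + (\int[mu]_x sin (T x)) ^+ 2.

Lemma continuous_cos_comp (T : R -> R) :
  continuous T -> continuous (fun x => cos (T x)).
Proof. by move=> Tc x; apply: continuous_comp; [exact: Tc|exact: continuous_cos]. Qed.

Lemma continuous_sin_comp (T : R -> R) :
  continuous T -> continuous (fun x => sin (T x)).
Proof. by move=> Tc x; apply: continuous_comp; [exact: Tc|exact: continuous_sin]. Qed.

Lemma sqnorm_exp_le2 (mu : probability borelR R) (T : R -> R) :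
  on_unit_interval mu -> continuous T -> sqnorm_exp mu T <= 2.
Proof.
move=> muI Tc.
have c1 := Rintegral_le_I01 muI (continuous_cos_comp Tc)
  (fun x => cos_max (T x)) (fun x _ => cos_max (T x)).
have s1 := Rintegral_le_I01 muI (continuous_sin_comp Tc)
  (fun x => sin_max (T x)) (fun x _ => sin_max (T x)).
have sq (u : R) : `|u| <= 1 -> u ^+ 2 <= 1.
  by move=> u1; rewrite -real_normK ?num_real// exprn_ile1.
by have := sq _ c1; have := sq _ s1; rewrite /sqnorm_exp; lra.
Qed.

(** With U x = T (l x), the integral of exp (i T) is (1 + exp (2 i gam)) / 2 times that of exp (i
    U), and the modulus of this factor is |cos gam|. *)
Lemma sqnorm_exp_branch (l gam : R) (mu : probability borelR R) (T : R -> R) :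
  bernoulli_convolution l mu -> continuous T ->
  (forall x, I01 x -> T (l * x + 1 - l) = T (l * x) + gam *+ 2) ->
  sqnorm_exp mu T = cos gam ^+ 2 * sqnorm_exp mu (fun x => T (l * x)).
Proof.
move=> bmu Tc Tg; have [muI _] := bmu.
pose U x := T (l * x).
have Uc : continuous U.
  by move=> x; apply: continuous_comp; [exact: mulrl_continuous|exact: Tc].
have cU := continuous_cos_comp Uc; have sU := continuous_sin_comp Uc.
have T1c : continuous (fun x => T (l * x + 1 - l)).
  move=> x; apply: (@continuous_comp _ _ _ (fun x : R => l * x + 1 - l) T).
    apply: cvgB; last exact: cvg_cst.
    by apply: cvgD; [exact: mulrl_continuous|exact: cvg_cst].
  exact: Tc.
have ci : mu.-integrable setT (EFin \o (fun x => cos (U x))).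
  by apply: (bounded_continuous_integrable _ cU) => x; exact: cos_max.
have si : mu.-integrable setT (EFin \o (fun x => sin (U x))).
  by apply: (bounded_continuous_integrable _ sU) => x; exact: sin_max.
set c := \int[mu]_x cos (U x); set s := \int[mu]_x sin (U x).
have lin (u v : R) : \int[mu]_x (u * cos (U x) + v * sin (U x)) = u * c + v * s.
  rewrite RintegralD//.
  - by rewrite !RintegralZl.
  - exact: (integrableZl measurableT u ci).
  - exact: (integrableZl measurableT v si).
have linc (u v : R) : continuous (fun x => u * cos (U x) + v * sin (U x)).
  by move=> x; apply: cvgD; apply: cvgM; [exact: cvg_cst|exact: cU|exact: cvg_cst|exact: sU].
have linb (u v : R) x : `|u * cos (U x) + v * sin (U x)| <= `|u| + `|v|.
  by rewrite (le_trans (ler_normD _ _))// lerD// normrM ler_piMr// ?cos_max ?sin_max.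
have c1 : \int[mu]_x cos (T (l * x + 1 - l)) =
    cos (gam *+ 2) * c + (- sin (gam *+ 2)) * s.
  rewrite -lin (Rintegral_I01 muI (continuous_cos_comp T1c) (fun x => cos_max _)).
  rewrite (Rintegral_I01 muI (linc _ _) (linb _ _)).
  by apply: eq_Rintegral => x; rewrite inE => xI; rewrite Tg// cosD /U; ring.
have s1 : \int[mu]_x sin (T (l * x + 1 - l)) =
    sin (gam *+ 2) * c + cos (gam *+ 2) * s.
  rewrite -lin (Rintegral_I01 muI (continuous_sin_comp T1c) (fun x => sin_max _)).
  rewrite (Rintegral_I01 muI (linc _ _) (linb _ _)).
  by apply: eq_Rintegral => x; rewrite inE => xI; rewrite Tg// sinD /U; ring.
have := bernoulli_Rintegral bmu (continuous_cos_comp Tc) (fun x => cos_max (T x)).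
have := bernoulli_Rintegral bmu (continuous_sin_comp Tc) (fun x => sin_max (T x)).
rewrite c1 s1 -/c -/s /sqnorm_exp -/c -/s.
set C' := \int[mu]_x cos (T x); set S' := \int[mu]_x sin (T x).
have := cos2Dsin2 (gam *+ 2); have := cos_mulr2n gam.
set c2 := cos (gam *+ 2); set s2 := sin (gam *+ 2); set k := cos gam.
move=> ck cs sS cC.
have {cC} -> : C' = ((1 + c2) * c - s2 * s) / 2 by lra.
have {sS} -> : S' = ((1 + c2) * s + s2 * c) / 2 by lra.
have -> : k ^+ 2 = (1 + c2) / 2 by lra.
have s22 : s2 ^+ 2 = 1 - c2 ^+ 2 by lra.
transitivity (((1 + c2) ^+ 2 + s2 ^+ 2) * (c ^+ 2 + s ^+ 2) / 4); first by field.
by rewrite s22; field.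
Qed.

Lemma sqnorm_exp_prod (l xi : R) (mu : probability borelR R) (G : R -> R)
    (A : nat -> R) (N : nat) :
  bernoulli_convolution l mu -> continuous G ->
  (forall n x, I01 x ->
    G (l ^+ n * (1 - l + l * x)) = G (l ^+ n * (l * x)) + A n) ->
  sqnorm_exp mu (fun x => 2 * pi * xi * G x) =
  (\prod_(n < N) cos (pi * xi * A n) ^+ 2) *
    sqnorm_exp mu (fun x => 2 * pi * xi * G (l ^+ N * x)).
Proof.
move=> bmu Gc GA; elim: N => [|N IH].
  rewrite big_ord0 mul1r; congr sqnorm_exp.
  by apply/funext => x; rewrite expr0 mul1r.
rewrite big_ord_recr/= IH (sqnorm_exp_branch bmu (gam := pi * xi * A N)).
- rewrite mulrA; congr (_ * sqnorm_exp _ _); apply/funext => x.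
  by rewrite exprSr mulrA.
- move=> x; apply: cvgM; first exact: cvg_cst.
  by apply: continuous_comp; [exact: mulrl_continuous|exact: Gc].
- move=> x xI; rewrite [l * x + 1 - l](_ : _ = 1 - l + l * x); last by ring.
  by rewrite GA// -mulr_natl; ring.
Qed.

Lemma ler_dist_cos (x y : R) : `|cos x - cos y| <= `|x - y|.
Proof.
wlog xy : x y / x <= y.
  by move=> W; case: (leP x y) => [|/ltW] /W//; rewrite distrC [`|y - x|]distrC.
have [c _ E] := MVT_segment xy (fun z _ => is_derive_cos z)
  (continuous_subspaceT (@continuous_cos R)).
by rewrite distrC E normrM normrN [`|x - y|]distrC ler_piMl// sin_max.
Qed.

Lemma ler_dist_sin (x y : R) : `|sin x - sin y| <= `|x - y|.
Proof.
wlog xy : x y / x <= y.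
  by move=> W; case: (leP x y) => [|/ltW] /W//; rewrite distrC [`|y - x|]distrC.
have [c _ E] := MVT_segment xy (fun z _ => is_derive_sin z)
  (continuous_subspaceT (@continuous_sin R)).
by rewrite distrC E normrM [`|x - y|]distrC ler_piMl// cos_max.
Qed.

Lemma sqrt_sqnorm_exp_dist (mu : probability borelR R) (T U : R -> R) (K : R) :
  on_unit_interval mu -> continuous T -> continuous U ->
  (forall x, I01 x -> `|T x - U x| <= K) ->
  Num.sqrt (sqnorm_exp mu T) <= Num.sqrt (sqnorm_exp mu U) + 2 * K.
Proof.
move=> muI Tc Uc TU.
have K0 : 0 <= K by rewrite (le_trans _ (TU 0 I01_0)).
have int (f : R -> R) : continuous f -> (forall x, `|f x| <= 1) ->
    mu.-integrable setT (EFin \o f).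
  by move=> fc; exact: bounded_continuous_integrable.
have diff (f g : R -> R) : continuous f -> continuous g ->
    (forall x, `|f x| <= 1) -> (forall x, `|g x| <= 1) ->
    (forall x, I01 x -> `|f x - g x| <= K) ->
    `|\int[mu]_x f x - \int[mu]_x g x| <= K.
  move=> fc gc f1 g1 fg; rewrite -RintegralB//; [|exact: int|exact: int].
  apply: (@Rintegral_le_I01 _ (fun x => f x - g x) 2) => //.
    by move=> x; apply: cvgB; [exact: fc|exact: gc].
  by move=> x; rewrite (le_trans (ler_normB _ _))//; have := f1 x; have := g1 x; lra.
have := diff _ _ (continuous_cos_comp Tc) (continuous_cos_comp Uc)
  (fun x => cos_max _) (fun x => cos_max _)
  (fun x xI => le_trans (ler_dist_cos _ _) (TU x xI)).
have := diff _ _ (continuous_sin_comp Tc) (continuous_sin_comp Uc)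
  (fun x => sin_max _) (fun x => sin_max _)
  (fun x xI => le_trans (ler_dist_sin _ _) (TU x xI)).
rewrite /sqnorm_exp.
set c := \int[mu]_x cos (T x); set s := \int[mu]_x sin (T x).
set c' := \int[mu]_x cos (U x); set s' := \int[mu]_x sin (U x).
move=> ss cc; set r := Num.sqrt (c' ^+ 2 + s' ^+ 2).
have r2 : r ^+ 2 = c' ^+ 2 + s' ^+ 2.
  by rewrite sqr_sqrtr// addr_ge0 ?sqr_ge0.
have r0 : 0 <= r by exact: sqrtr_ge0.
have rK : 0 <= r + 2 * K by rewrite addr_ge0// mulr_ge0.
rewrite -[leRHS]ger0_norm// -sqrtr_sqr ler_wsqrtr//.
have c'r : `|c'| <= r.
  by rewrite -sqrtr_sqr ler_wsqrtr// lerDl sqr_ge0.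
have s'r : `|s'| <= r.
  by rewrite -sqrtr_sqr ler_wsqrtr// lerDr sqr_ge0.
have aux (u v : R) : `|u - v| <= K -> `|v| <= r ->
    u ^+ 2 <= v ^+ 2 + 2 * K * r + K ^+ 2.
  move=> uv vr.
  have -> : u ^+ 2 = v ^+ 2 + 2 * (v * (u - v)) + (u - v) ^+ 2 by ring.
  have h1 : v * (u - v) <= K * r.
    by rewrite (le_trans (ler_norm _))// normrM mulrC ler_pM.
  have h2 : (u - v) ^+ 2 <= K ^+ 2.
    by rewrite -real_normK ?num_real// lerXn2r ?nnegrE.
  by move: h1 h2; lra.
have := aux _ _ cc c'r; have := aux _ _ ss s'r.
have K2 : 0 <= K ^+ 2 by exact: sqr_ge0.
have -> : (r + 2 * K) ^+ 2 = c' ^+ 2 + s' ^+ 2 + 4 * (K * r) + 4 * K ^+ 2.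
  by rewrite -r2; ring.
by lra.
Qed.

Lemma normc_fourier (mu : probability borelR R) (g : {mfun borelR >-> borelR})
    (xi : R) : continuous (g : R -> R) ->
  normc (fourier (distribution mu g) xi) =
  Num.sqrt (sqnorm_exp mu (fun x => 2 * pi * xi * g x)).
Proof.
move=> gc; rewrite /fourier /= /sqnorm_exp sqrrN.
have lc : continuous (fun t : R => 2 * pi * xi * t) by exact: mulrl_continuous.
rewrite (Rintegral_distribution _ (continuous_cos_comp lc) (fun x => cos_max _))//.
by rewrite (Rintegral_distribution _ (continuous_sin_comp lc) (fun x => sin_max _)).
Qed.

End fourier_product.

(** * Choice of the displacements *)

Section selection.
Context {R : realType}.

(* The mean of cos ^+ (2 m). *)
Definition cos_mean (m : nat) : R := \prod_(i < m) ((2 * i + 1)%:R / (2 * i + 2)%:R).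

Lemma cos_meanS m :
  cos_mean m.+1 = (2 * m + 1)%:R / (2 * m + 2)%:R * cos_mean m.
Proof. by rewrite /cos_mean big_ord_recr/= mulrC. Qed.

Lemma cos_mean_gt0 m : 0 < cos_mean m.
Proof. by apply: prodr_gt0 => i _; rewrite divr_gt0// ltr0n; lia. Qed.

(** The left-hand side decreases in m, with ratio (2m+1)(2m+3) / (2m+2)^2 < 1 as in the Wallis
    product, from its value 3/4 at m = 1. *)
Lemma cos_mean_sq m : (0 < m)%N -> cos_mean m ^+ 2 * (2 * m + 1)%:R <= 3 / 4.
Proof.
elim: m => [//|[_ _|m IH _]].
  rewrite cos_meanS /cos_mean big_ord0 mulr1.
  by change ((1%:R / 2%:R) ^+ 2 * 3%:R <= 3 / 4 :> R); lra.
apply: le_trans (IH isT); rewrite cos_meanS exprMn -mulrA [leLHS]mulrCA.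
rewrite ler_wpM2l ?sqr_ge0//.
have -> : (2 * m.+1 + 1)%:R = 2 * m%:R + 3 :> R by rewrite -!natrM -!natrD; congr _%:R; lia.
have -> : (2 * m.+1 + 2)%:R = 2 * m%:R + 4 :> R by rewrite -!natrM -!natrD; congr _%:R; lia.
have -> : (2 * m.+2 + 1)%:R = 2 * m%:R + 5 :> R by rewrite -!natrM -!natrD; congr _%:R; lia.
have m0 : 0 <= m%:R :> R by [].
have z4 : 0 < (2 * m%:R + 4) ^+ 2 :> R by rewrite exprn_gt0//; lra.
rewrite expr_div_n mulrAC ler_pdivrMr//.
by move: (m%:R) m0 => z z0; rewrite !expr2; nra.
Qed.

(** The reduction formula for powers of the cosine splits a primitive into the linear mean part and
    a remainder Q, and each reduction adds at most 1 to the bound on Q. So averages over long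
    intervals are close to [cos_mean m], wherever the interval lies. *)
Lemma cos_pow_antiderivative m : exists Q : R -> R,
  (forall x, `|Q x| <= m%:R) /\
  forall x : R, is_derive x 1 (fun y => cos_mean m * y + Q y) (cos x ^+ (2 * m)).
Proof.
elim: m => [|m [Q [Qm QD]]].
  exists (cst 0); split => [x|x]; first by rewrite normr0.
  rewrite /cos_mean big_ord0 muln0 expr0.
  apply: (is_derive_eq (is_deriveD (is_deriveZ 1 (is_derive_id x 1)) (is_derive_cst 0 x 1))).
  by rewrite addr0 /GRing.scale/= mulr1.
pose a : R := (2 * m + 1)%:R / (2 * m + 2)%:R.
pose c : R := (2 * m + 2)%:R^-1.
have c0 : 0 < c by rewrite invr_gt0 ltr0n; lia.
have c1 : c <= 1 by rewrite invf_le1 ?ltr0n ?ler1n; lia.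
have a1 : a <= 1 by rewrite ler_pdivrMr ?ltr0n ?mul1r ?ler_nat; lia.
have a0 : 0 <= a by rewrite divr_ge0.
exists (fun x => a * Q x + c * (cos x ^+ (2 * m).+1 * sin x)); split=> x.
  rewrite -natr1 (le_trans (ler_normD _ _))// lerD//.
    by rewrite normrM (ger0_norm a0) (le_trans _ (Qm x))// ler_piMl.
  rewrite normrM (gtr0_norm c0) mulr_ile1 ?(ltW c0)//.
  by rewrite normrM mulr_ile1 ?normrX ?exprn_ile1 ?cos_max ?sin_max ?exprn_ge0.
have cosX := is_deriveX (2 * m).+1 (is_derive_cos x).
have dcs := is_deriveM cosX (is_derive_sin x).
have d := is_deriveD (is_deriveZ a (QD x)) (is_deriveZ c dcs).
have E : (fun y => cos_mean m.+1 * y + (a * Q y + c * (cos y ^+ (2 * m).+1 * sin y))) =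
    (a *: (fun y => cos_mean m * y + Q y) : R -> R) + (c *: (cos ^+ (2 * m).+1 * sin : R -> R) : R -> R).
  apply/funext => y; rewrite cos_meanS -/a.
  change (a * cos_mean m * y + (a * Q y + c * (cos y ^+ (2 * m).+1 * sin y)) =
    a * (cos_mean m * y + Q y) + c * ((cos ^+ (2 * m).+1 : R -> R) y * sin y)).
  by rewrite exprfctE; ring.
rewrite E; apply: (is_derive_eq d); rewrite exprfctE /GRing.scale/=.
have m2 : (2 * m + 2)%:R != 0 :> R by rewrite pnatr_eq0; lia.
have -> : (2 * m.+1 = (2 * m).+2)%N by lia.
rewrite /a /c [(2 * m + 1)%N]addn1 !exprS.
have -> : (2 * m).+1%:R = (2 * m + 2)%:R - 1 :> R.
  by rewrite addn2 -[in RHS]natr1 addrK.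
have s2 := sin2cos2 x; rewrite !expr2 in s2.
move: (2 * m + 2)%:R m2 => k k0; move: (cos x ^+ (2 * m)) => p.
move: (cos x) (sin x) s2 => C S s2.
have -> : S * ((k - 1) * p * - S) = - (k - 1) * p * (S * S) by ring.
by rewrite s2; field.
Qed.

(* A bound on the value at some common point, for all partial sums at once,
   by compactness of [0, T] and the mean value theorem. *)
Lemma select_point (T B : R) (u : nat -> R) (f F : nat -> R -> R) :
  0 < T -> (forall j, 0 <= u j) ->
  (forall J, \sum_(j < J) u j <= B) ->
  (forall j, continuous (f j)) -> (forall j t, 0 <= f j t) ->
  (forall j (t : R), is_derive t 1 (F j) (f j t)) ->
  (forall j, F j T - F j 0 <= T) ->
  exists t, 0 <= t <= T /\ forall J, \sum_(j < J) u j * f j t <= B.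
Proof.
move=> T0 u0 uB fc f0 FD FT.
pose S J t := \sum_(j < J) u j * f j t.
have Sc J : continuous (S J).
  move=> t; rewrite /S; elim: J => [|J IH].
    by under eq_fun do rewrite big_ord0; exact: cvg_cst.
  under eq_fun do rewrite big_ord_recr/=.
  by apply: cvgD => //; apply: cvgM; [exact: cvg_cst|exact: fc].
have pt J : exists t, t \in `[0, T] /\ S J t <= B.
  pose P t := \sum_(j < J) u j * F j t.
  have PD (t : R) : is_derive t 1 P (S J t).
    rewrite /P /S; clear P; elim: J => [|J IH].
      under eq_fun do rewrite big_ord0; rewrite big_ord0; exact: is_derive_cst.
    under eq_fun do rewrite big_ord_recr/=; rewrite big_ord_recr/=.
    exact: (is_deriveD IH (is_deriveZ (u J) (FD J t))).
  have [c cT E] := MVT_segment (ltW T0) (fun t _ => PD t)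
    (continuous_subspaceT (derive_continuous PD)).
  exists c; split=> //; rewrite -(ler_pM2r T0) -[X in _ * X <= _]subr0 -E.
  rewrite /P -sumrB (@le_trans _ _ (\sum_(j < J) u j * T))//.
    by apply: ler_sum => j _; rewrite -mulrBr ler_wpM2l.
  by rewrite -mulr_suml ler_wpM2r ?(ltW T0).
have [t tP] := choice pt.
have [|p [pT pc]] := @segment_compact R 0 T (t @ \oo) _.
  by exists 0%N => // n _; exact: (tP n).1.
exists p; split; first by move: pT; rewrite /= in_itv.
move=> K; rewrite leNgt; apply/negP => BK.
have nK : nbhs p [set x | B < S K x].
  exact: (cvgr_gt _ (Sc K p) _ BK).
(* The terms are nonnegative, so the bound on the n-th sum passes to every shorter one. *)
have eK : (t @ \oo) [set x | S K x <= B].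
  exists K => // n /= Kn; apply: le_trans (tP n).2.
  rewrite /S (big_ord_widen n (fun j => u j * f j (t n)))// [leRHS](bigID (fun j : 'I_n => (j < K)%N))/=.
  by rewrite lerDl sumr_ge0// => j _; rewrite mulr_ge0.
by have [x [/= x1 x2]] := pc _ _ eK nK; move: x1; rewrite leNgt x2.
Qed.

(** Method of conditional expectations: at step n the weight of j is w j times the factors already
    fixed, and [select_point] picks d n so that the total over all j stays at most 1. Each single
    term is then at most 1. *)
Lemma select_sequence (T : nat -> R) (w : nat -> R) (f : nat -> nat -> R -> R) :
  (forall n, 0 < T n) -> (forall j, 0 <= w j) ->
  (forall J, \sum_(j < J) w j <= 1) ->
  (forall n j, continuous (f n j)) -> (forall n j t, 0 <= f n j t) ->
  (forall n j, exists2 F : R -> R, (forall t : R, is_derive t 1 F (f n j t)) &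
    F (T n) - F 0 <= T n) ->
  exists d : nat -> R, (forall n, 0 <= d n <= T n) /\
    forall n j, w j * \prod_(i < n) f i j (d i) <= 1.
Proof.
move=> T0 w0 w1 fc f0 fF.
pose good (u : nat -> R) := (forall j, 0 <= u j) /\ forall J, \sum_(j < J) u j <= 1.
have step n u : exists t, good u ->
    0 <= t <= T n /\ good (fun j => u j * f n j t).
  have [gu|gu] := pselect (good u); last by exists 0.
  have [F Fn] := choice (fun j => (let: ex_intro2 F FD FT := fF n j in
    ex_intro (fun F => (forall t : R, is_derive t 1 F (f n j t)) /\ F (T n) - F 0 <= T n)
      F (conj FD FT))).
  have [t [tT tS]] := select_point (T0 n) gu.1 gu.2 (fc n) (f0 n)
    (fun j => (Fn j).1) (fun j => (Fn j).2).
  by exists t => _; do 2?split=> //; move=> j; rewrite mulr_ge0 ?gu.1.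
have [sel selP] := choice (fun nu : nat * (nat -> R) => step nu.1 nu.2).
pose v := fix v n : nat -> R := if n is m.+1 then
  fun j => v m j * f m j (sel (m, v m)) else w.
have gv n : good (v n).
  by elim: n => [//|n IH] /=; exact: (selP (n, v n) IH).2.
exists (fun n => sel (n, v n)); split=> [n|n j].
  exact: (selP (n, v n) (gv n)).1.
have -> : w j * \prod_(i < n) f i j (sel (i : nat, v i)) = v n j.
  elim: n => [|n IH]; first by rewrite big_ord0 mulr1.
  by rewrite big_ord_recr/= mulrA IH.
have [v0 v1] := gv n; apply: le_trans (v1 j.+1).
by rewrite big_ord_recr/= lerDr sumr_ge0.
Qed.

Lemma lerX (n : nat) (x y : R) : 0 <= x -> x <= y -> x ^+ n <= y ^+ n.
Proof. by move=> x0 xy; apply: lerXn2r; rewrite ?nnegrE// (le_trans x0). Qed.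

Lemma expR1_ge : 244 / 100 <= expR 1 :> R.
Proof.
have E : expR 1 = expR (1 / 4) ^+ 4 :> R.
  by rewrite -expRM_natl; congr expR; lra.
have h0 : 5 / 4 <= expR (1 / 4) :> R by apply: le_trans (expR_ge1Dx _); lra.
have h1 : 0 <= 5 / 4 :> R by lra.
rewrite E; apply: le_trans (lerX 4 h1 h0).
by rewrite !exprS expr0; lra.
Qed.

(** 92/100 bounds 2 times 0.1672 times 11/4, and 3/8 is half the constant of [cos_mean_sq]; both
    occur in [cos_mean_small]. The bound 1 + x <= exp x is too weak at -0.92, so it is applied to a
    tenth of it. *)
Lemma expR_m092_ge : 3 / 8 <= expR (- (92 / 100)) :> R.
Proof.
have E : expR (- (92 / 100)) = expR (- (92 / 1000)) ^+ 10 :> R.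
  by rewrite -expRM_natl; congr expR; lra.
have h0 : 908 / 1000 <= expR (- (92 / 1000)) :> R.
  by apply: le_trans (expR_ge1Dx _); lra.
have h1 : 0 <= 908 / 1000 :> R by lra.
rewrite E; apply: le_trans (lerX 10 h1 h0).
by rewrite !exprS expr0; lra.
Qed.

Lemma decay_constant_le : 2 * pi / (18 * expR 1 + pi) <= 1672 / 10000 :> R.
Proof.
have e1 := expR1_ge; have p0 := @pi_gt0 R; have p2 := @pihalf_lt2 R.
have p4 : pi <= 4 :> R by lra.
by rewrite ler_pdivrMr; lra.
Qed.

(** As [cos_mean m] is of order m^(-1/2), m must be at least of order q^-2, while the exponential
    stays bounded below only for bounded q^2 m. *)
Lemma cos_mean_small (q k : R) : 0 < q <= 1 / 2 -> 0 <= k <= 1672 / 10000 ->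
  exists2 m : nat, (0 < m)%N &
    cos_mean m < q * expR (- (k * q ^+ 2 * (2 * m + 1)%:R)).
Proof.
move=> /andP[q0 q2] /andP[k0 k1].
(* Hence 1 < q^2 m <= 1 + q^2, and q^2 (2 m + 1) <= 2 + 3 q^2 <= 11/4. *)
pose m := (Num.truncn (q ^- 2)).+1.
have qq0 : 0 < q ^+ 2 by rewrite exprn_gt0.
have qq4 : q ^+ 2 <= 1 / 4 by rewrite expr2; nra.
have qi : 0 <= q ^- 2 by rewrite invr_ge0 ltW.
have /andP[m1 m2] := truncn_itv qi.
have mq : 1 < q ^+ 2 * m%:R by rewrite -ltr_pdivrMl// mulr1.
have mq' : q ^+ 2 * m%:R <= 1 + q ^+ 2.
  by rewrite /m -natr1 mulrDr mulr1 lerD2r -ler_pdivlMl// mulr1.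
have mE : (2 * m + 1)%:R = 2 * m%:R + 1 :> R by rewrite natrD natrM.
exists m => //; set E := expR _.
have E0 : 0 < E by exact: expR_gt0.
have EE : 3 / 8 <= E ^+ 2.
  apply: le_trans expR_m092_ge _; rewrite -expRM_natl ler_expR mE.
  have : k * (q ^+ 2 * (2 * m%:R + 1)) <= 1672 / 10000 * (11 / 4).
    by apply: ler_pM => //; [rewrite mulr_ge0 ?ltW//; lra|lra].
  by rewrite mulrN mulrA; lra.
have c0 := cos_mean_gt0 m.
rewrite -(ltr_pXn2r (n := 2)) ?nnegrE ?mulr_ge0 ?(ltW q0) ?(ltW E0) ?(ltW c0)//.
have := @cos_mean_sq m isT; rewrite mE exprMn => cm.
have h1 : q ^+ 2 * (3 / 8) <= q ^+ 2 * E ^+ 2 by rewrite ler_pM2l.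
apply: lt_le_trans h1.
have m00 : 0 <= m%:R :> R by [].
have m0 : 0 < 2 * m%:R + 1 :> R by lra.
rewrite -(ltr_pM2r m0); apply: (le_lt_trans cm).
have -> : q ^+ 2 * (3 / 8) * (2 * m%:R + 1) =
  3 / 4 * (q ^+ 2 * m%:R) + 3 / 8 * q ^+ 2 by field.
by lra.
Qed.

Lemma powR_diff_ge (eps : R) (k : nat) : 0 < eps -> (0 < k)%N ->
  eps * k.+1%:R `^ (- eps - 1) <= k%:R `^ (- eps) - k.+1%:R `^ (- eps).
Proof.
move=> e0 k0; have kR : 0 < k%:R :> R by rewrite ltr0n.
have kk : k%:R <= k.+1%:R :> R by rewrite ler_nat.
have D (x : R) : x \in `[k%:R, k.+1%:R] ->
    is_derive x 1 (fun y => y `^ (- eps)) (- eps * x `^ (- eps - 1)).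
  rewrite in_itv => /andP[x0 _].
  by apply: is_derive1_powR; exact: lt_le_trans x0.
have C : {within `[k%:R, k.+1%:R], continuous (fun y : R => y `^ (- eps))}.
  by apply: derivable_within_continuous => x /D[].
have [x xk E] := MVT_segment kk (fun x xk => D x (subset_itv_oo_cc xk)) C.
have -> : k%:R `^ (- eps) - k.+1%:R `^ (- eps) = eps * x `^ (- eps - 1).
  by rewrite -opprB E -natr1; ring.
move: xk; rewrite in_itv/= => /andP[x0 x1]; rewrite ler_pM2l//.
have x00 : 0 < x by exact: lt_le_trans x0.
rewrite -opprD !powRN lef_pV2 ?posrE ?powR_gt0//.
by apply: ge0_ler_powR => //; rewrite ?nnegrE ?(ltW x00)// addr_ge0// ltW.
Qed.

End selection.

(** * Simultaneous decay along a sequence of frequencies *)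

Section decay_selection.
Context {R : realType}.

(** The weights are differences of consecutive values of j^(-eps): telescoping bounds their sums,
    the mean value theorem their inverses. *)
Lemma frequency_weights (eps : R) : 0 < eps <= 1 -> exists w : nat -> R,
  [/\ forall j, 0 < w j, forall J, \sum_(j < J) w j <= 1 &
      forall j, (w j)^-1 <= 4 / eps * j.+1%:R `^ (1 + eps)].
Proof.
move=> /andP[e0 e1].
pose g j : R := j.+1%:R `^ (- eps).
have wl j : eps * j.+2%:R `^ (- eps - 1) <= g j - g j.+1.
  exact: powR_diff_ge.
have p0 j : 0 < eps * j.+2%:R `^ (- eps - 1) by rewrite mulr_gt0// powR_gt0.
exists (fun j => g j - g j.+1); split=> [j|J|j].
- exact: lt_le_trans (p0 j) (wl j).
- have -> : \sum_(j < J) (g j - g j.+1) = g 0%N - g J.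
    elim: J => [|J IH]; first by rewrite big_ord0 subrr.
    by rewrite big_ord_recr/= IH; ring.
  by rewrite /g powR1 gerBl powR_ge0.
apply: (@le_trans _ _ (eps * j.+2%:R `^ (- eps - 1))^-1).
  by rewrite lef_pV2 ?posrE// (lt_le_trans (p0 j)).
rewrite -opprD powRN invfM invrK mulrC [4 / eps]mulrC -mulrA mulrC ler_pM2l ?invr_gt0//.
have -> : 4 = 2 `^ 2%:R :> R by rewrite powR_mulrn// expr2; lra.
apply: (@le_trans _ _ (2 `^ (1 + eps) * j.+1%:R `^ (1 + eps))); last first.
  by rewrite ler_wpM2r ?powR_ge0// ler_powR//; lra.
rewrite -powRM ?ler0n// addrC; apply: ge0_ler_powR.
- by rewrite addr_ge0// ltW.
- by rewrite nnegrE ler0n.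
- by rewrite nnegrE mulr_ge0 ?ler0n.
- by rewrite -natrM ler_nat; lia.
Qed.

(** Over an interval of length T the bounded part of the primitive of cos^(2m) contributes at most 2
    m, which the slack om T (M' - cos_mean m) absorbs, for any offset c. *)
Lemma averaged_factor (m : nat) (M' om c T : R) :
  cos_mean m < M' -> 0 < om -> 0 < T ->
  2 * m%:R / (M' - cos_mean m) <= om * T ->
  exists2 F : R -> R,
    (forall t : R, is_derive t 1 F (cos (om * (c + t)) ^+ (2 * m) / M')) &
    F T - F 0 <= T.
Proof.
move=> mM om0 T0 omT.
have M'0 : 0 < M' by exact: lt_trans (cos_mean_gt0 m) mM.
have [Q [Qm QD]] := @cos_pow_antiderivative R m.
pose W y := cos_mean m * y + Q y.
exists (fun t => (om * M')^-1 * W (om * t + om * c)).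
  move=> t.
  have d := is_deriveZ (om * M')^-1 (is_derive_comp_affine (QD (om * t + om * c))).
  apply: (is_derive_eq d); rewrite /GRing.scale/= -mulrDr [t + c]addrC.
  by field; rewrite !gt_eqF.
rewrite -mulrBr ler_pdivrMl ?mulr_gt0// mulr0 add0r /W.
have dQ : Q (om * T + om * c) - Q (om * c) <= 2 * m%:R.
  have := Qm (om * T + om * c); have := Qm (om * c).
  by rewrite !ler_norml => /andP[? ?] /andP[? ?]; lra.
have : 2 * m%:R <= om * T * (M' - cos_mean m).
  by rewrite -ler_pdivrMr ?subr_gt0.
by lra.
Qed.

Lemma geometric_threshold (q X : R) : 0 < q < 1 ->
  exists N : nat, q ^+ N * X < 1 /\ forall i, (i < N)%N -> 1 <= q ^+ i * X.
Proof.
move=> /andP[q0 q1].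
have ex : exists n : nat, q ^+ n * X < 1.
  have cv : q ^+ n * X @[n --> \oo] --> 0 * X.
    by apply: cvgM; [apply: cvg_expr; rewrite gtr0_norm|exact: cvg_cst].
  rewrite mul0r in cv; have [N _ NP] := cvgr_lt _ cv 1 ltr01.
  by exists N; apply: NP => /=.
case: (ex_minnP ex) => N NX Nmin; exists N; split=> // i iN.
by rewrite leNgt; apply/negP => /Nmin; rewrite leqNgt iN.
Qed.

Lemma powR_exprn (x t : R) (n : nat) : (x `^ t) ^+ n = x `^ (t * n%:R).
Proof. by rewrite powRrM powR_mulrn// powR_ge0. Qed.

(** If N levels are averaged at xi, the selection gives Pr^m <= M'^N / w j. Here M'^N is of order
    xi^(-rho), and 1 / w j of order xi^((1+tau)(1+eps)) because j.+1 = xi^(1+tau). The hypothesis on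
    [cos_mean m] says that rho can exceed 1 + tau (2m+1), so after paying for the weight the decay
    xi^(-2 m tau) remains. *)
Lemma decay_selection (q tau e : R) (m : nat) (a : nat -> R) :
  0 < q < 1 -> 0 < tau -> 0 < e -> (0 < m)%N ->
  cos_mean m < q `^ (1 + tau * (2 * m + 1)%:R) ->
  exists d : nat -> R, (forall n, 0 <= d n <= e * q ^+ n) /\
    exists2 C : R, 0 < C & forall j : nat,
      let xi := j.+1%:R `^ (1 + tau)^-1 in
      exists N : nat,
        Num.sqrt (\prod_(n < N) cos (pi * xi * (a n + d n)) ^+ 2) <=
          C * xi `^ (- tau).
Proof.
move=> q01 tau0 e0 m0; have /andP[q0 q1] := q01.
set E := 1 + _; set P0 := q `^ E => cP.
have c0 := @cos_mean_gt0 R m.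
pose M' := (cos_mean m + P0) / 2.
have cM : cos_mean m < M' by rewrite /M'; lra.
have MP : M' < P0 by rewrite /M'; lra.
have M'0 : 0 < M' by exact: lt_trans cM.
have lnq : ln q < 0 by rewrite ln_lt0.
pose rho := ln M' / ln q.
have qrho : q `^ rho = M'.
  by rewrite /powR gt_eqF// /rho divfK ?lt_eqF// lnK.
have rhoE : E < rho.
  have : ln M' < ln P0 by rewrite ltr_ln// posrE powR_gt0.
  by rewrite ln_powR /rho ltr_ndivlMr.
(* The slack rho - E pays for the extra (1 + tau) eps in the exponent of the weights. *)
pose eps := Num.min 1 ((rho - E) / (1 + tau)).
have tau1 : 0 < 1 + tau by lra.
have eps0 : 0 < eps by rewrite lt_min ltr01 divr_gt0 ?subr_gt0.
have eps1 : 0 < eps <= 1 by rewrite eps0 ge_min lexx.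
have epsE : (1 + tau) * (1 + eps) + tau * (2 * m)%:R <= rho.
  have : eps * (1 + tau) <= rho - E.
    by rewrite -ler_pdivlMr// ge_min lexx orbT.
  by rewrite /E natrD; lra.
have [w [w0 w1 wV]] := frequency_weights eps1.
pose R0 := 2 * m%:R / (M' - cos_mean m).
have R00 : 0 < R0 by rewrite divr_gt0 ?subr_gt0// mulr_gt0// ltr0n.
pose xi (j : nat) : R := j.+1%:R `^ (1 + tau)^-1.
have xi0 j : 0 < xi j by rewrite powR_gt0.
have xi1 j : 1 <= xi j.
  by rewrite -[leLHS](powRr0 j.+1%:R) ler_powR// ?ler1n// invr_ge0 ltW.
pose T n := e * q ^+ n.
have T0 n : 0 < T n by rewrite mulr_gt0// exprn_gt0.
have pxi j : 0 < pi * xi j by rewrite mulr_gt0// pi_gt0.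
(* A level is averaged only while its phase range pi xi T is large; the others get the factor 1. *)
pose f i j t := if R0 <= pi * xi j * T i
  then cos (pi * xi j * (a i + t)) ^+ (2 * m) / M' else 1.
have ev (u : R) : 0 <= u ^+ (2 * m) by rewrite exprM exprn_ge0// sqr_ge0.
have f0 i j t : 0 <= f i j t.
  by rewrite /f; case: ifP => // _; rewrite divr_ge0// ltW.
have fF i j : exists2 F : R -> R, (forall t : R, is_derive t 1 F (f i j t)) &
    F (T i) - F 0 <= T i.
  rewrite /f; have [act|_] := boolP (R0 <= pi * xi j * T i).
    exact: averaged_factor.
  by exists id => [t|]; [exact: is_derive_id|rewrite subr0].
have fc i j : continuous (f i j).
  rewrite /f; have [_|_] := boolP (R0 <= pi * xi j * T i); last first.
    by move=> t; exact: cvg_cst.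
  move=> t; apply: cvgM; last exact: cvg_cst.
  apply: (@continuous_comp _ _ _ (fun t => cos (pi * xi j * (a i + t))) (fun y => y ^+ (2 * m))).
    apply: continuous_cos_comp => {}t; apply: cvgM; first exact: cvg_cst.
    by apply: cvgD; [exact: cvg_cst|exact: cvg_id].
  exact: exprn_continuous.
have [d [dT dw]] := select_sequence T0 (fun j => ltW (w0 j)) w1 fc f0 fF.
exists d; split=> //.
pose K := (R0 / (pi * e)) `^ rho * (4 / eps).
have K0 : 0 <= K by rewrite mulr_ge0 ?powR_ge0// divr_ge0// ltW.
exists (1 + K); first by rewrite ltr_pwDl.
move=> j; rewrite -/(xi j) /=.
(* The levels below [N] are averaged, and [N] is the first that is not: q^N < R0 / (pi e xi), which
   bounds M'^N by a multiple of xi^(-rho). *)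
have [N [NX Nact]] := geometric_threshold (pi * e * xi j / R0) q01.
exists N; set Pr := \prod_(n < N) _.
have Pr0 : 0 <= Pr by apply: prodr_ge0 => i _; exact: sqr_ge0.
have prodE : \prod_(i < N) f i j (d i) = Pr ^+ m * (M' ^+ N)^-1.
  have fE i : (i < N)%N ->
      f i j (d i) = (cos (pi * xi j * (a i + d i)) ^+ 2) ^+ m / M'.
    move=> iN; rewrite /f ifT ?exprM//.
    have := Nact i iN; rewrite mulrA ler_pdivlMr// mul1r => /le_trans; apply.
    by rewrite /T le_eqVlt; apply/orP; left; apply/eqP; ring.
  rewrite /Pr; elim: (N) fE => [|k IH] fE; first by rewrite !big_ord0 !expr1n expr0 invr1 mulr1.
  rewrite !big_ord_recr/= IH => [|i ik]; last by rewrite fE// ltnW.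
  by rewrite fE// mulf_div [in RHS]exprMn [M' ^+ k.+1]exprSr.
have rho0 : 0 <= rho.
  by rewrite (le_trans _ (ltW rhoE))// /E addr_ge0// mulr_ge0// ltW.
have MN : M' ^+ N <= (R0 / (pi * e)) `^ rho * xi j `^ (- rho).
  rewrite -qrho -powR_mulrn ?powR_ge0// powRAC powR_mulrn ?(ltW q0)//.
  have pe0 : 0 < pi * e by rewrite mulr_gt0// pi_gt0.
  have -> : xi j `^ (- rho) = (xi j)^-1 `^ rho.
    by rewrite -(powR_inv1 (ltW (xi0 j))) -powRrM mulN1r.
  have NX' : q ^+ N <= R0 / (pi * e) * (xi j)^-1.
    have -> : R0 / (pi * e) * (xi j)^-1 = 1 / (pi * e * xi j / R0).
      by rewrite div1r invf_div (invfM (pi * e)) [RHS]mulrA.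
    by rewrite ltW// ltr_pdivlMr// divr_gt0// mulr_gt0.
  have Rpe : 0 <= R0 / (pi * e) by rewrite divr_ge0 ?ltW.
  have xiV : 0 <= (xi j)^-1 by rewrite invr_ge0 ltW.
  rewrite -powRM//; apply: ge0_ler_powR => //.
    by rewrite nnegrE exprn_ge0// ltW.
  by rewrite nnegrE mulr_ge0.
have PrB : Pr ^+ m <= K * xi j `^ (- (tau * (2 * m)%:R)).
  have := dw N j; rewrite prodE mulrA ler_pdivrMr ?exprn_gt0// mul1r.
  rewrite mulrC -ler_pdivlMr// => /le_trans; apply.
  apply: (@le_trans _ _ ((R0 / (pi * e)) `^ rho * xi j `^ (- rho) *
      (4 / eps * j.+1%:R `^ (1 + eps)))).
    by apply: ler_pM => //; [rewrite exprn_ge0// ltW|rewrite invr_ge0 ltW].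
  have -> : j.+1%:R = xi j `^ (1 + tau).
    by rewrite /xi -powRrM mulVf ?gt_eqF// powRr1.
  rewrite -powRrM /K mulrACA -mulrA -[leRHS]mulrA.
  rewrite ler_wpM2l ?powR_ge0// ler_wpM2l ?divr_ge0 ?(ltW eps0)//.
  rewrite -powRD ?(gt_eqF (xi0 j)) ?implybT// ler_powR//.
  by move: epsE; lra.
rewrite -(ler_pXn2r (n := 2 * m)) ?nnegrE ?sqrtr_ge0 ?muln_gt0//; last first.
  by rewrite mulr_ge0 ?powR_ge0 ?addr_ge0.
rewrite exprM sqr_sqrtr// (le_trans PrB)// exprMn.
rewrite powR_exprn mulNr; apply: ler_wpM2r; first exact: powR_ge0.
have K1 : 1 <= 1 + K by rewrite lerDl.
apply: (@le_trans _ _ (1 + K)); first by rewrite lerDr.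
have m20 : (0 < 2 * m)%N by rewrite muln_gt0.
exact: (ler_eXnr m20 K1).
Qed.

End decay_selection.

(** * Support of the measure and decay at all frequencies *)

Section smooth_image_decay.
Context {R : realType}.
Local Notation borelR := (measurableTypeR R).

(** By invariance the gaps of level n + 1 get their mass from their preimages under the two
    branches, which inside [0,1] lie in gaps of level n; those of the middle gap miss [0,1]. The
    null set outside [0,1] is carried along. *)
Lemma bernoulli_gapn0 (l : R) (mu : probability borelR R) n :
  0 < l -> l < 1 / 2 -> bernoulli_convolution l mu ->
  mu [set x | gapn l n x] = 0%E.
Proof.
move=> l0 l2 [muI muE].
have mI : measurable (~` I01 : set borelR).
  by apply: measurableC; exact: measurable_itv.
have mg k : measurable ([set x | gapn l k x] : set borelR).
  by apply: open_measurable; exact: open_gapn.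
have e0c : continuous (e0 l : R -> R) by exact: mulrl_continuous.
have e1c : continuous (e1 l : R -> R).
  move=> x; apply: cvgB; last exact: cvg_cst.
  by apply: cvgD; [exact: e0c|exact: cvg_cst].
have mp (e : R -> R) k : continuous e -> measurable (e @^-1` [set x | gapn l k x] : set borelR).
  by move=> ec; apply: open_measurable; apply: open_comp => [x _|]; [exact: ec|exact: open_gapn].
have le0 (A B : set borelR) : measurable A -> measurable B -> A `<=` B ->
    mu B = 0%E -> mu A = 0%E.
  move=> mA mB AB B0; apply/eqP; rewrite eq_le measure_ge0 andbT -B0.
  by rewrite le_measure ?inE.
have e1E x : e1 l x = 1 - l + l * x by rewrite /e1; ring.
elim: n => [|n IH].
  rewrite muE// /pushforward !(le0 _ _ _ mI _ (measure_setC_I01 muI)) ?mule0 ?adde0//.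
  - exact: mp.
  - by move=> x /= + xI; rewrite e1E => /(gapn_lMD l0 l2 0 xI)[].
  - exact: mp.
  - by move=> x /= + xI => /(gapn_lM l0 l2 0 xI)[].
have B0 : mu (~` I01 `|` [set x | gapn l n x]) = 0%E.
  apply/eqP; rewrite eq_le measure_ge0 andbT.
  have -> : 0%E = (mu (~` I01) + mu [set x | gapn l n x])%E :> \bar R.
    by rewrite measure_setC_I01// IH adde0.
  exact: measureU2.
have mB := measurableU _ _ mI (mg n).
rewrite muE// /pushforward !(le0 _ _ _ mB _ B0) ?mule0 ?adde0//.
- exact: mp.
- move=> x gx; have [xI|xI] := pselect (I01 x); last by left.
  have {}gx : gapn l n.+1 (1 - l + l * x) by rewrite -e1E.
  by right; move: gx => /(gapn_lMD l0 l2 _ xI)[m [->]].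
- exact: mp.
- move=> x gx; have [xI|xI] := pselect (I01 x); last by left.
  have {}gx : gapn l n.+1 (l * x) by [].
  by right; move: gx => /(gapn_lM l0 l2 _ xI)[m [->]].
Qed.

Lemma bernoulli_support (l : R) (mu : probability borelR R) x :
  0 < l -> l < 1 / 2 -> bernoulli_convolution l mu ->
  topological_support mu x -> I01 x /\ forall n, ~ gapn l n x.
Proof.
move=> l0 l2 bmu sx; split=> [|n gx].
  apply: contrapT => xI.
  have := sx (~` I01) _ xI; rewrite measure_setC_I01 ?ltxx; last by case: bmu.
  have : open (~` (I01 : set R)) by apply: closed_openC; exact: interval_closed.
  by move=> oI /(_ oI).
by have := sx _ (@open_gapn _ l n) gx; rewrite bernoulli_gapn0// ltxx.
Qed.

Lemma sqnorm_expN (mu : probability borelR R) (T : R -> R) : continuous T ->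
  sqnorm_exp mu (fun x => - T x) = sqnorm_exp mu T.
Proof.
move=> Tc; rewrite /sqnorm_exp; congr (_ ^+ 2 + _).
  by apply: eq_Rintegral => x _; rewrite cosN.
rewrite -[RHS]sqrrN -mulN1r -RintegralZl//; last first.
  apply: (bounded_continuous_integrable _ (continuous_sin_comp Tc)) => x.
  exact: sin_max.
by congr (_ ^+ 2); apply: eq_Rintegral => x _; rewrite sinN mulN1r.
Qed.

(* Frequencies ξ_j = j ^ (1 / (1 + tau)) have gaps at most ξ_j ^ (- tau), and
   the Fourier transform is Lipschitz. *)
Lemma frequency_net (tau z : R) : 0 < tau -> 1 <= z ->
  exists j : nat, let xi := j.+1%:R `^ (1 + tau)^-1 in
    [/\ xi <= z, z - xi <= xi `^ (- tau) & xi `^ (- tau) <= 2 `^ tau * z `^ (- tau)].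
Proof.
move=> t0 z1; have z0 : 0 < z by exact: lt_le_trans z1.
have t1 : 0 < 1 + tau by lra.
have b0 : 0 <= (1 + tau)^-1 by rewrite invr_ge0 ltW.
have zt0 : 0 <= z `^ (1 + tau) by exact: powR_ge0.
have zt1 : 1 <= z `^ (1 + tau).
  by rewrite -[leLHS](powRr0 z) ler_powR// ltW.
have /andP[k1 k2] := truncn_itv zt0.
have k0 : (0 < Num.truncn (z `^ (1 + tau)))%N by rewrite truncn_gt0.
case: (Num.truncn _) k0 k1 k2 => [//|j] _ k1 k2; exists j => xi.
have zE : z = (z `^ (1 + tau)) `^ (1 + tau)^-1.
  by rewrite -powRrM mulfV ?gt_eqF// powRr1// ltW.
have j0 : 0 < j.+1%:R :> R by rewrite ltr0n.
have xi0 : 0 < xi by exact: powR_gt0.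
have xiz : xi <= z.
  by rewrite [leRHS]zE; apply: ge0_ler_powR; rewrite ?nnegrE// ltW.
have jE : j.+1%:R = xi `^ (1 + tau).
  by rewrite /xi -powRrM mulVf ?gt_eqF// powRr1// ltW.
have zxi : z <= xi * (1 + j.+1%:R^-1).
  apply: (@le_trans _ _ (j.+2%:R `^ (1 + tau)^-1)).
    rewrite [leLHS]zE; apply: ge0_ler_powR; rewrite ?nnegrE//; exact: ltW.
  have -> : j.+2%:R = j.+1%:R * (1 + j.+1%:R^-1) :> R.
    by rewrite mulrDr mulr1 divff ?gt_eqF// natr1.
  rewrite powRM ?(ltW j0) ?addr_ge0 ?invr_ge0 ?(ltW j0)// ler_pM2l//.
  apply: ler1_powR; first by rewrite lerDl invr_ge0 ltW.
  by rewrite invf_le1// lerDl ltW.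
clearbody xi.
have xij : xi / j.+1%:R = xi `^ (- tau).
  have xin0 : xi != 0 by rewrite gt_eqF.
  have xi1 : xi `^ 1 = xi by apply: powRr1; exact: ltW.
  have xit : xi `^ (1 + tau) = xi `^ 1 * xi `^ tau.
    by apply: powRD; rewrite xin0 implybT.
  by rewrite jE xit xi1 invfM mulrA divff// mul1r powRN.
split=> //; first by move: zxi; rewrite mulrDr mulr1 xij -lerBlDl.
have z2 : z <= 2 * xi.
  have : j.+1%:R^-1 <= 1 :> R by rewrite invf_le1// ler1n.
  move: (j.+1%:R^-1) zxi => i zxi i1.
  by apply: (le_trans zxi); rewrite mulrC ler_pM2r//; move: i1; clear; lra.
have -> : 2 `^ tau * z `^ (- tau) = (z / 2) `^ (- tau).
  rewrite powRM ?invr_ge0 ?(ltW z0)// mulrC; congr (_ * _).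
  by rewrite -(powR_inv1 (ler0n R 2)) -powRrM mulN1r opprK.
rewrite !powRN lef_pV2 ?posrE ?powR_gt0 ?divr_gt0//.
by apply: ge0_ler_powR; rewrite ?nnegrE ?(ltW t0) ?(ltW xi0) ?divr_ge0 ?(ltW z0)// ler_pdivrMr// mulrC.
Qed.

(** With q = l^s and k = 2 pi / (18 e + pi), the exponent is tau = k q^2 / log (1/q), so that q^(tau
    (2m+1)) = exp (- k q^2 (2m+1)). *)
Lemma decay_exponent_threshold (l s : R) : 0 < l -> l < 1 / 2 -> 1 <= s ->
  exists2 m : nat, (0 < m)%N &
    cos_mean m < (l `^ s) `^ (1 + decay_exponent s l * (2 * m + 1)%:R).
Proof.
move=> l0 l2 s1; have s0 : 0 < s by exact: lt_le_trans s1.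
pose q := l `^ s; have q0 : 0 < q by exact: powR_gt0.
have ql : q <= l.
  rewrite -[leRHS]powRr1 ?(ltW l0)//; apply: ger_powR => //.
  by rewrite l0/=; lra.
have q12 : 0 < q <= 1 / 2 by rewrite q0/=; lra.
pose k : R := 2 * pi / (18 * expR 1 + pi).
have k0 : 0 <= k.
  apply: divr_ge0; first by apply: mulr_ge0 => //; exact: pi_ge0.
  apply: addr_ge0; last exact: pi_ge0.
  by apply: mulr_ge0 => //; exact: expR_ge0.
have k1 : 0 <= k <= 1672 / 10000 by rewrite k0 decay_constant_le.
have [m m0 cm] := cos_mean_small q12 k1; exists m => //.
suff -> : q `^ (1 + decay_exponent s l * (2 * m + 1)%:R) =
    q * expR (- (k * q ^+ 2 * (2 * m + 1)%:R)) by [].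
rewrite powRD; last by rewrite (gt_eqF q0) implybT.
rewrite powRr1 ?(ltW q0)//; congr (_ * _).
rewrite {1}/powR (gt_eqF q0); congr expR.
have lnl : ln l < 0 by rewrite ln_lt0// l0/=; lra.
have q2 : l `^ (2 * s) = q ^+ 2.
  by rewrite -powR_mulrn ?powR_ge0// /q -powRrM mulrC.
have D0 : 18 * expR 1 + pi != 0 :> R.
  rewrite gt_eqF//; apply: addr_gt0; last exact: pi_gt0.
  by apply: mulr_gt0 => //; exact: expR_gt0.
rewrite /decay_exponent lnV ?posrE// q2 ln_powR /k.
move: (18 * expR 1 + pi) (ln l) D0 lnl => D L D0 L0.
by field; rewrite D0 (gt_eqF s0) (lt_eqF L0).
Qed.

Lemma decay_exponent_gt0 (l s : R) : 0 < l -> l < 1 / 2 -> 1 <= s ->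
  0 < decay_exponent s l.
Proof.
move=> l0 l2 s1; have s0 : 0 < s by exact: lt_le_trans s1.
have lnl : ln l < 0 by rewrite ln_lt0// l0/=; lra.
have D0 : 0 < 18 * expR 1 + pi :> R.
  apply: addr_gt0; last exact: pi_gt0.
  by apply: mulr_gt0 => //; exact: expR_gt0.
have L0 : 0 < ln l^-1 by rewrite lnV ?posrE// oppr_gt0.
rewrite /decay_exponent; apply: divr_gt0.
  by apply: mulr_gt0; [rewrite mulr_gt0// pi_gt0|exact: powR_gt0].
by apply: mulr_gt0 => //; exact: mulr_gt0.
Qed.

Lemma smooth_image_with_decay (l : R) (mu : probability borelR R) (r : nat) (alpha : R) :
  0 < l -> l < 1 / 2 -> bernoulli_convolution l mu ->
  (1 <= r)%N -> 0 < alpha <= 1 ->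
  let tau := decay_exponent (r%:R + alpha) l in
  exists g : {mfun borelR >-> borelR},
    [/\ diffeo01 r alpha g, self_conformal (distribution mu g),
        (exists2 eta : R, 0 < eta &
           forall x, topological_support mu x -> deriv01 g x = eta) &
        exists2 C : R, 0 < C & forall xi : R, xi != 0 ->
          normc (fourier (distribution mu g) xi) <= C * `|xi| `^ (- tau)].
Proof.
(* With r = p + 1, the derivative [psi] is of class C^(p, alpha) and its primitive G one order
   better. *)
move=> l0 l2 bmu; case: r => [//|p] _ a01 tau; have /andP[a0 a1] := a01.
have [muI _] := bmu.
pose s : R := p.+1%:R + alpha.
have sE : s = p%:R + 1 + alpha by rewrite /s -natr1.
have p0 : 0 <= p%:R :> R by exact: ler0n.
have s1 : 1 <= s by rewrite sE; lra.
have tau0 : 0 < tau by exact: decay_exponent_gt0.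
have [m m0 cm] := decay_exponent_threshold l0 l2 s1.
set q := l `^ s in cm.
have q0 : 0 < q by exact: powR_gt0.
have q01 : 0 < q < 1.
  rewrite q0/=; apply: (@le_lt_trans _ _ l); last by lra.
  rewrite -[leRHS]powRr1 ?(ltW l0)//; apply: ger_powR => //.
  by rewrite l0/=; lra.
have [e e0 pres] := prescribed_increments l0 l2 p a01.
have [d [dT [C C0 dC]]] :=
  decay_selection (fun n => l ^+ n * (1 - l)) q01 tau0 e0 m0 cm.
have [n|G [psi [GD [psib psic] psis psi1 [G0 GA]]]] := pres d.
  have /andP[d0 d1] := dT n.
  by rewrite ger0_norm// -sE.
have [g [eta [eta0 gE gdiff gself gder]]] :=
  normalized_conjugation l0 l2 a01 bmu GD psib psic psis G0.
exists g; split=> //.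
  exists eta => // x /(bernoulli_support l0 l2 bmu)[xI gx].
  by apply: gder => //; exact: psi1.
have Gc := derive_continuous GD.
pose T z (x : R) := 2 * pi * z * G x.
have Tc z : continuous (T z).
  by move=> x; apply: cvgM; [exact: cvg_cst|exact: Gc].
pose H z := Num.sqrt (sqnorm_exp mu (T z)).
have GI x : I01 x -> `|G x| <= 2.
  move=> xI.
  have psi2 y : I01 y -> `|psi y| <= 2.
    by move=> _; have /andP[? ?] := psib y; rewrite ler_norml; lra.
  have := derivative_bounded_lipschitz (fun y _ => GD y) psi2 xI I01_0.
  by rewrite G0 !subr0 => /le_trans; apply; rewrite ler_piMr// -[x]subr0 I01_dist_le1//; exact: I01_0.
have sq2 (U : R -> R) : continuous U -> Num.sqrt (sqnorm_exp mu U) <= 2.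
  move=> Uc; have h := sqnorm_exp_le2 muI Uc.
  rewrite -[leRHS]ger0_norm// -sqrtr_sqr ler_wsqrtr//.
  by apply: (le_trans h); rewrite expr2; lra.
have HN z : H (- z) = H z.
  rewrite /H -(sqnorm_expN mu (Tc z)); congr (Num.sqrt (sqnorm_exp _ _)).
  by apply/funext => x; rewrite /T; ring.
(* As |G| <= 2 on [0,1], the phases differ by at most 4 pi |z - z'|, which [sqrt_sqnorm_exp_dist]
   doubles. *)
have HL z z' : H z <= H z' + 8 * pi * `|z - z'|.
  rewrite /H.
  have TT x : I01 x -> `|T z x - T z' x| <= 4 * pi * `|z - z'|.
    move=> xI; have -> : T z x - T z' x = 2 * pi * (z - z') * G x by rewrite /T; ring.
    rewrite !normrM (gtr0_norm (@pi_gt0 R)) ger0_norm//.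
    have -> : 4 * pi * `|z - z'| = 2 * pi * `|z - z'| * 2 by ring.
    by rewrite ler_wpM2l ?GI// !mulr_ge0// pi_ge0.
  have := sqrt_sqnorm_exp_dist muI (Tc z) (Tc z') TT.
  by have -> : 2 * (4 * pi * `|z - z'|) = 8 * pi * `|z - z'| by ring.
have Hnet j : let xi := j.+1%:R `^ (1 + tau)^-1 in H xi <= 2 * C * xi `^ (- tau).
  move=> xi; have [N PN] := dC j; rewrite -/xi in PN.
  have := sqnorm_exp_prod xi N bmu Gc GA; rewrite -/(T xi) => E.
  rewrite /H E sqrtrM; last by apply: prodr_ge0 => i _; exact: sqr_ge0.
  have -> : 2 * C * xi `^ (- tau) = C * xi `^ (- tau) * 2 by ring.
  apply: ler_pM; [exact: sqrtr_ge0|exact: sqrtr_ge0|exact: PN|apply: sq2].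
  move=> x; apply: cvgM; first exact: cvg_cst.
  by apply: continuous_comp; [exact: mulrl_continuous|exact: Gc].
pose C1 := (2 * C + 8 * pi) * 2 `^ tau.
have C10 : 0 < C1.
  apply: mulr_gt0; last exact: powR_gt0.
  by apply: addr_gt0; apply: mulr_gt0 => //; exact: pi_gt0.
(* Moving from the net to z costs 8 pi xi^(-tau), the same order as the bound at xi. For z < 1 the
   trivial bound 2 suffices, z^(-tau) being at least 1. *)
have Hpos z : 0 < z -> H z <= (C1 + 2) * z `^ (- tau).
  move=> z0; have [z1|z1] := leP 1 z.
    have [j] := frequency_net tau0 z1; set xi := _ `^ _ => -[xiz zxi xiB].
    have zX : `|z - xi| <= xi `^ (- tau) by rewrite ger0_norm ?subr_ge0.
    have p8 : 0 <= 8 * pi :> R by rewrite mulr_ge0// pi_ge0.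
    apply: (le_trans (HL z xi)).
    apply: (@le_trans _ _ ((2 * C + 8 * pi) * xi `^ (- tau))).
      by rewrite [leRHS]mulrDl; apply: lerD; [exact: Hnet|exact: ler_wpM2l].
    apply: (@le_trans _ _ (C1 * z `^ (- tau))).
      rewrite /C1 -mulrA; apply: ler_wpM2l => //.
      by apply: addr_ge0 => //; apply: mulr_ge0 => //; exact: ltW.
    by rewrite ler_wpM2r ?powR_ge0// lerDl.
  apply: (le_trans (sq2 _ (Tc z))).
  have z1' : 1 <= z `^ (- tau).
    rewrite powRN invf_ge1 ?powR_gt0//; apply: powR_le1; last exact: ltW.
    by rewrite !ltW.
  apply: (@le_trans _ _ (2 * z `^ (- tau))); first by rewrite ler_peMr.
  by rewrite ler_wpM2r ?powR_ge0// lerDr ltW.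
(* The frequency xi for g = eta G is the frequency xi eta for G. *)
exists ((C1 + 2) * eta `^ (- tau)).
  by apply: mulr_gt0; [exact: addr_gt0|exact: powR_gt0].
move=> xi xi0; have gc : continuous (g : R -> R).
  have -> : (g : R -> R) = (fun x => eta * G x) by apply/funext => x; exact: gE.
  by move=> x; apply: cvgM; [exact: cvg_cst|exact: Gc].
rewrite normc_fourier//.
have -> : (fun x => 2 * pi * xi * g x) = T (xi * eta).
  by apply/funext => x; rewrite gE /T; ring.
rewrite -/(H _) -mulrA -powRM ?(ltW eta0)//.
have nE : eta * `|xi| = `|xi * eta| by rewrite normrM (gtr0_norm eta0) mulrC.
have ne0 : 0 < `|xi * eta| by rewrite normr_gt0 mulf_neq0// gt_eqF.
rewrite nE; have := Hpos _ ne0.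
suff -> : H `|xi * eta| = H (xi * eta) by [].
by have [/ger0_norm ->|/ltW/ler0_norm ->] := leP 0 (xi * eta); rewrite ?HN.
Qed.

End smooth_image_decay.

(** * Pisot numbers *)

Section power_sums.
Variable F : fieldType.
Implicit Types (r : seq F) (j : nat).

Let Pi r : {poly F} := \prod_(z <- r) ('X - z%:P).

(* The sum over z in r of z ^+ j times the product of the other factors: the
   remainder of 'X^j * (Pi r)^`() modulo Pi r. *)
Fixpoint weighted_deriv j r : {poly F} :=
  if r is z :: s then z ^+ j *: Pi s + ('X - z%:P) * weighted_deriv j s else 0.

Lemma weighted_derivP j r : Pi r %| 'X^j * (Pi r)^`() - weighted_deriv j r.
Proof.
elim: r => [|z s IH] /=; first by rewrite /Pi big_nil derivC mulr0 subr0 dvdp0.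
rewrite /Pi big_cons -/(Pi s) derivM derivXsubC mul1r.
have -> : 'X^j * (Pi s + ('X - z%:P) * (Pi s)^`()) -
    (z ^+ j *: Pi s + ('X - z%:P) * weighted_deriv j s) =
  ('X^j - (z ^+ j)%:P) * Pi s +
    ('X - z%:P) * ('X^j * (Pi s)^`() - weighted_deriv j s).
  by rewrite -mul_polyC; ring.
apply: dvdp_add; last by rewrite dvdp_mul2l ?polyXsubC_eq0.
apply: dvdp_mul => //; rewrite dvdp_XsubCl /root.
by rewrite !hornerE subrr.
Qed.

Lemma weighted_deriv_size j r : (size (weighted_deriv j r) <= size r)%N.
Proof.
elim: r => [|z s IH] /=; first by rewrite size_poly0.
rewrite (leq_trans (size_polyD _ _))// geq_max; apply/andP; split.
  by rewrite (leq_trans (size_scale_leq _ _))// size_prod_XsubC.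
rewrite (leq_trans (size_polyMleq _ _))// size_XsubC.
by rewrite add2n ltnS.
Qed.

Lemma weighted_deriv_coef j r :
  (weighted_deriv j r)`_(size r).-1 = \sum_(z <- r) z ^+ j.
Proof.
elim: r => [|z s IH] /=; first by rewrite coef0 big_nil.
rewrite big_cons coefD coefZ mulrBl coefB coefXM coefCM.
rewrite [(weighted_deriv j s)`_(size s)]nth_default ?weighted_deriv_size//.
have -> : (Pi s)`_(size s) = 1.
  have /monicP := monic_prod_XsubC s xpredT id.
  by rewrite lead_coefE size_prod_XsubC.
rewrite mulr1 mulr0 subr0; case: s IH => [|y s] IH /=; first by rewrite big_nil.
by rewrite -IH.
Qed.

(** The power sum is a coefficient of the remainder of X^j p' modulo p, and division by a monic
    integer polynomial stays over the integers. The integer remainder and [weighted_deriv] agree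
    because their difference is divisible by p and of smaller degree. *)
Lemma power_sum_int (p : {poly int}) r j : p \is monic ->
  map_poly intr p = Pi r -> exists n : int, \sum_(z <- r) z ^+ j = n%:~R.
Proof.
move=> pm pE; pose rho := Pdiv.Ring.rmodp ('X^j * p^`()) p.
have rho_eq := Pdiv.RingMonic.rdivp_eq pm ('X^j * p^`()).
have szm (q : {poly int}) : (size (map_poly intr q : {poly F}) <= size q)%N.
  exact: size_poly.
have szp : size p = (size r).+1.
  rewrite -(size_prod_XsubC r id) -[in RHS]/(Pi r) -pE size_map_poly_id0//.
  by rewrite (monicP pm) oner_neq0.
have rhoE : map_poly intr rho = weighted_deriv j r.
  apply/eqP; rewrite -subr_eq0; apply/negPn/negP => nz.
  have : Pi r %| map_poly intr rho - weighted_deriv j r.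
    have -> : map_poly intr rho - weighted_deriv j r =
        ('X^j * (Pi r)^`() - weighted_deriv j r) -
        map_poly intr (Pdiv.Ring.rdivp ('X^j * p^`()) p) * Pi r.
      have -> : 'X^j * (Pi r)^`() =
          map_poly intr (Pdiv.Ring.rdivp ('X^j * p^`()) p) * Pi r +
          map_poly intr rho.
        rewrite -pE deriv_map -(map_polyXn (intr : {rmorphism int -> F})).
        by rewrite -2!rmorphM -rmorphD -rho_eq.
      ring.
    by rewrite dvdp_sub ?weighted_derivP ?dvdp_mulIr.
  move=> /(dvdp_leq nz); rewrite size_prod_XsubC leqNgt => /negP; apply.
  rewrite ltnS (leq_trans (size_polyD _ _))// size_polyN geq_max.
  rewrite weighted_deriv_size andbT (leq_trans (szm _))// -ltnS -szp.
  by rewrite Pdiv.Ring.ltn_rmodpN0// monic_neq0.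
exists rho`_(size r).-1.
by rewrite -weighted_deriv_coef -rhoE coef_map.
Qed.

End power_sums.

Section pisot_numbers.
Variable R : realType.
Implicit Types (x : R) (j : nat).

(** Rational root theorem for denominator 2: after clearing denominators every term but the leading
    a^d is even. *)
Lemma half_odd_not_integral (p : {poly int}) (a : int) :
  p \is monic -> root (map_poly intr p) (a%:~R / 2 : R) -> (2 %| a)%Z.
Proof.
move=> pm; rewrite /root => /eqP ra0.
have [d szp] : exists d, size p = d.+1.
  by exists (size p).-1; rewrite prednK// size_poly_gt0 monic_neq0.
have pd : p`_d = 1 by have /monicP := pm; rewrite lead_coefE szp.
have {ra0} : \sum_(i < d.+1) p`_i * a ^+ i * 2 ^+ (d - i) = 0.
  apply: (@intr_inj R); rewrite rmorph_sum /= -[RHS](mulr0 (2 ^+ d)) -[X in _ * X]ra0.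
  rewrite (horner_coef_wide _ (n := d.+1)) -?szp ?size_poly// szp mulr_sumr.
  apply: eq_bigr => i _; rewrite coef_map /= !rmorphM !rmorphXn /= expr_div_n.
  have -> : 2 ^+ d = 2 ^+ (d - i) * 2 ^+ i :> R.
    by rewrite -exprD subnK// -ltnS.
  have /= h : 2 ^+ i != 0 :> R by rewrite expf_neq0.
  by field.
rewrite big_ord_recr/= pd mul1r subnn expr0 mulr1 => /eqP; rewrite addr_eq0.
move=> /eqP sE; suff : (2 %| a ^+ d)%Z.
  by rewrite !dvdzE abszX Euclid_dvdX// => /andP[].
rewrite -rpredN -sE; apply: rpred_sum => i _.
by apply/dvdz_mull; rewrite -(subnSK (ltn_ord i)) exprS dvdz_mulr.
Qed.

Lemma pisot_conjugates_le (s : seq R[i]) (y : R[i]) :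
  {in s, forall z, z != y -> normc z < 1} ->
  exists2 rho : R, 0 < rho < 1 & {in s, forall z, z != y -> normc z <= rho}.
Proof.
elim: s => [|z s IH] s1; first by exists (2^-1) => //; lra.
have [|rho rho01 sle] := IH; first by move=> w ws; apply: s1; rewrite inE ws orbT.
have [zy|zy] := eqVneq z y.
  exists rho => // w; rewrite inE => /orP[/eqP-> /eqP//|]; exact: sle.
exists (Num.max rho (normc z)).
  by rewrite lt_max gt_max; case/andP: rho01 => -> ->; rewrite s1// inE eqxx.
move=> w; rewrite inE le_max => /orP[/eqP->|ws wy]; first by rewrite lexx orbT.
by rewrite sle.
Qed.

Lemma normc_sum_exp_le (s : seq R[i]) (y : R[i]) (rho : R) j : 0 <= rho ->
  {in s, forall z, z != y -> normc z <= rho} ->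
  normc (\sum_(z <- s | z != y) z ^+ j) <= (size s)%:R * rho ^+ j.
Proof.
move=> rho0; elim: s => [|z s IH] sle.
  by rewrite big_nil mul0r ComplexField.Normc.normc0.
rewrite big_cons /= -natr1 mulrDl mul1r.
have {}IH : normc (\sum_(z <- s | z != y) z ^+ j) <= (size s)%:R * rho ^+ j.
  by apply: IH => w ws; apply: sle; rewrite inE ws orbT.
case: ifPn => zy; last by rewrite (le_trans IH)// lerDl exprn_ge0.
rewrite (le_trans (le_normcD _ _))// addrC lerD//.
have zr := sle z (mem_head _ _) zy.
elim: j {IH} => [|j IH]; first by rewrite !expr0 ComplexField.Normc.normc1.
rewrite !exprS ComplexField.Normc.normcM ler_pM//.
  by rewrite /normc; case: (z) => *; exact: sqrtr_ge0.
by rewrite /normc; case: (z ^+ j) => *; exact: sqrtr_ge0.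
Qed.

Lemma pisot_near_int x : pisot x ->
  exists2 rho : R, 0 < rho < 1 &
  exists2 K : R, 0 <= K &
  forall j, exists n : int, `|x ^+ j - n%:~R| <= K * rho ^+ j.
Proof.
move=> [_ [p [pm pirr px conj]]].
pose pC : {poly R[i]} := map_poly intr p.
pose xC := real_complex R x.
have [r] := closed_field_poly_normal pC.
have -> : lead_coef pC = 1.
  by apply/monicP; rewrite monic_map.
rewrite scale1r => pE.
have root_r z : (z \in r) = root pC z by rewrite pE root_prod_XsubC.
(* Separability makes x a simple root, so that removing it once from the power sum leaves only
   conjugates of modulus less than 1. *)
have ur : uniq r.
  rewrite -separable_prod_XsubC -pE.
  have -> : pC = map_poly ratr (map_poly intr p : {poly rat}).
    by rewrite -map_poly_comp; apply: eq_map_poly => z; rewrite /= ratr_int.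
  rewrite separable_map unlock irreducible_poly_coprime//.
  have pQ0 : map_poly intr p != 0 :> {poly rat} by rewrite monic_neq0 ?monic_map.
  have [sz _] := pirr; set q := map_poly intr p in pQ0 sz *.
  apply/negP => /dvdp_leq; rewrite leqNgt lt_size_deriv//= => H.
  have : q^`()`_(size q).-2 == 0.
    by case: eqVneq H => [-> _|_ /(_ isT)//]; rewrite coef0.
  rewrite coef_deriv; case: (size q) sz (lead_coefE q) => [|[|n]]//= _ <-.
  by rewrite mulrn_eq0 /= lead_coef_eq0 (negPf pQ0).
have xr : xC \in r.
  rewrite root_r.
  have -> : pC = map_poly (real_complex R) (map_poly intr p).
    by rewrite -map_poly_comp; apply: eq_map_poly => z; rewrite /= rmorph_int.
  by rewrite fmorph_root.
have [rho rho01 rle] : exists2 rho : R, 0 < rho < 1 &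
    {in r, forall z, z != xC -> normc z <= rho}.
  by apply: pisot_conjugates_le => z; rewrite root_r; exact: conj.
exists rho => //; exists (size r)%:R => // j.
have [n nE] := power_sum_int j pm pE.
exists n; have rho0 : 0 <= rho by case/andP: rho01 => /ltW.
apply: le_trans (normc_sum_exp_le j rho0 rle).
move: nE; rewrite (bigD1_seq xC)//= => nE.
have -> : \sum_(z <- r | z != xC) z ^+ j = real_complex R (n%:~R - x ^+ j).
  by rewrite rmorphB rmorphXn rmorph_int -nE addrAC subrr add0r.
by rewrite /= expr0n addr0 sqrtr_sqr distrC.
Qed.

End pisot_numbers.

(** * Cosine products along the powers of a Pisot number *)

Section pisot_cos.
Variable R : realType.

Lemma norm_cosDpi (a : R) (n : int) : `|cos (a + pi * n%:~R)| = `|cos a|.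
Proof.
have nat_case (b : R) (k : nat) : `|cos (b + pi * k%:R)| = `|cos b|.
  elim: k => [|k IH]; first by rewrite mulr0 addr0.
  by rewrite -natr1 mulrDr mulr1 addrA cosDpi normrN.
case: n => k; first exact: nat_case.
by rewrite NegzE rmorphN /= mulrN -[in RHS](subrK (pi * k.+1%:R) a) nat_case.
Qed.

Lemma norm_cos_near_int (t : R) (n : int) :
  1 - pi * `|t - n%:~R| <= `|cos (pi * t)|.
Proof.
have c1 : `|cos (pi * n%:~R : R)| = 1.
  by rewrite -[pi * _]add0r norm_cosDpi cos0 normr1.
rewrite -[X in X - _]c1 -[X in _ - X * _](ger0_norm (pi_ge0 R)) -normrM mulrBr.
rewrite lerBlDr -lerBlDl (le_trans (lerB_dist _ _))//.
by rewrite distrC; exact: ler_dist_cos.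
Qed.

(** A zero would put x^j, an algebraic integer, in 1/2 + Z. This covers small j, where closeness to
    integers says nothing. *)
Lemma pisot_cos_neq0 (x : R) j : pisot x -> cos (pi * x ^+ j) != 0.
Proof.
move=> [_ [p [pm _ px _]]]; apply/negP => /eqP c0.
have [q qm qx] : integralOver (intr : int -> R) (x ^+ j).
  elim: j {c0} => [|j IH]; first exact: integral1.
  by rewrite exprS; apply: integral_mul => //; exists p.
pose m := Num.floor (x ^+ j); pose u := x ^+ j - m%:~R.
have u01 : 0 <= u < 1.
  rewrite subr_ge0 ltrBlDl -intrD1 /m; have := ge_floor (x ^+ j).
  by have := floorD1_gt (x ^+ j) => -> ->.
have : `|cos (pi * u)| = 0.
  by rewrite /u mulrBr -mulrN -rmorphN norm_cosDpi c0 normr0.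
move=> /eqP; rewrite normr_eq0 => /eqP cu0.
have p0 := pi_gt0 R.
have uE : pi * u = pi / 2.
  apply: cos_inj; rewrite ?cu0 ?cos_pihalf// in_itv/=; apply/andP; split; nra.
have {}uE : u = 1 / 2 by apply: (mulfI (lt0r_neq0 p0)); rewrite uE mul1r.
have : (2 %| m * 2 + 1)%Z.
  apply: (half_odd_not_integral (R := R) qm).
  have -> : (m * 2 + 1)%:~R / 2 = x ^+ j.
    rewrite intrD intrM; have : x ^+ j = u + m%:~R by rewrite /u subrK.
    by rewrite uE => ->; field.
  by [].
by rewrite rpredDl ?dvdz_mull.
Qed.

(** Beyond a J where the tail of K rho^j sums to at most 1/2, the inequality prod (1 - a_j) >= 1 -
    sum a_j loses at most half of the product; the finitely many earlier factors are positive. *)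
Lemma prod_bounded_below (c : nat -> R) (K rho : R) : 0 < rho < 1 -> 0 <= K ->
  (forall j, 0 < c j <= 1) -> (forall j, 1 - K * rho ^+ j <= c j) ->
  exists2 d : R, 0 < d & forall k, d <= \prod_(j < k) c j.
Proof.
move=> /andP[r0 r1] K0 c01 cge.
have s0 : 0 < 1 - rho by rewrite subr_gt0.
have [J KJ] : exists J, K * rho ^+ J / (1 - rho) <= 1 / 2.
  have [|J [KJ _]] := geometric_threshold (q := rho) (K / (1 - rho) * 2).
    by rewrite r0.
  by exists J; rewrite mulrAC; lra.
pose P k := \prod_(j < k) c j.
have PS k : P k.+1 = P k * c k by rewrite /P big_ord_recr.
have P_gt0 k : 0 < P k.
  by apply: prodr_gt0 => j _; case/andP: (c01 j).
have P_dec i k : P (k + i)%N <= P k.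
  elim: i => [|i IH]; first by rewrite addn0.
  rewrite addnS PS (le_trans _ IH)// ler_piMr ?(ltW (P_gt0 _))//.
  by case/andP: (c01 (k + i)%N).
pose e i := K * rho ^+ J * (1 - rho ^+ i) / (1 - rho).
have tail i : P J * (1 - e i) <= P (J + i)%N.
  elim: i => [|i IH].
    by rewrite addn0 /e expr0 subrr mulr0 mul0r subr0 mulr1.
  have -> : e i.+1 = e i + K * rho ^+ (J + i).
    by rewrite /e exprD exprS; field; rewrite lt0r_neq0.
  rewrite addnS PS.
  have := ler_wpM2l (ltW (P_gt0 (J + i)%N)) (cge (J + i)%N).
  have Ke : 0 <= K * rho ^+ (J + i) by rewrite mulr_ge0// exprn_ge0// ltW.
  by have := ler_wpM2r Ke (P_dec i J); nra.
exists (P J / 2) => [|k]; first by rewrite divr_gt0.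
rewrite -/(P k) (le_trans _ (P_dec J k))// addnC (le_trans _ (tail k))//.
rewrite ler_pM2l//; suff : e k <= 1 / 2 by lra.
rewrite (le_trans _ KJ)// /e ler_pM2r ?invr_gt0// ler_piMr//.
  by rewrite mulr_ge0// exprn_ge0// ltW.
by rewrite lerBlDr lerDl exprn_ge0// ltW.
Qed.

End pisot_cos.

(** * Failure of the Rajchman property for Pisot parameters *)

Section pisot_not_rajchman.
Variable R : realType.
Local Notation borelR := (measurableTypeR R).
Variables (l : R) (mu : probability borelR R).
Hypotheses (l0 : 0 < l) (l2 : l < 1 / 2) (bmu : bernoulli_convolution l mu).

Ltac slra := move: (l0) (l2) => ? ?; lra.

Let S (xi : R) := sqnorm_exp mu (fun x => 2 * pi * xi * x).

Lemma normc_fourier_self (xi : R) : normc (fourier mu xi) = Num.sqrt (S xi).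
Proof. by rewrite /fourier /= sqrrN. Qed.

Lemma sqnorm_bernoulli (xi : R) N :
  S xi = (\prod_(n < N) cos (pi * (xi * (1 - l) * l ^+ n)) ^+ 2) *
    S (xi * l ^+ N).
Proof.
rewrite /S (@sqnorm_exp_prod _ l xi mu id (fun n => l ^+ n * (1 - l)) N)//; first 1 last.
- by move=> x; exact: cvg_id.
- by move=> n x _; ring.
congr (_ * _); first by apply: eq_bigr => n _; congr (cos _ ^+ 2); ring.
by congr sqnorm_exp; apply/funext => x; ring.
Qed.

(** The factors are the squares of cos (pi l^n): of modulus 1 for n = 0, nonzero for n >= 1 since l
    < 1/2. After N of them the frequency is so small that the transform is close to its value 1 at
    0. *)
Lemma sqnorm_bernoulli_unit_gt0 : 0 < S (1 - l)^-1.
Proof.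
have l1 : 0 < 1 - l by slra.
pose K := 2 * pi / (1 - l).
have p0 := pi_gt0 R.
have K0 : 0 < K by rewrite divr_gt0// mulr_gt0.
(* Makes the remaining phase at most 1/4, so the square root of [S] there is at least 1 - 2/4. *)
have [|N [NK _]] := geometric_threshold (q := l) (K * 4); first by slra.
rewrite (sqnorm_bernoulli _ N) mulr_gt0//.
  apply: prodr_gt0 => n _; rewrite exprn_even_gt0//= mulVf ?(lt0r_neq0 l1)// mul1r.
  case: (n : nat) => [|k]; first by rewrite expr0 mulr1 cospi oppr_eq0 oner_eq0.
  apply: lt0r_neq0; apply: cos_gt0_pihalf.
  have lk : 0 < l ^+ k.+1 by rewrite exprn_gt0.
  have lk2 : l ^+ k.+1 < 1 / 2.
    apply: le_lt_trans l2; rewrite exprS ler_piMr ?(ltW l0)// exprn_ile1 ?ltW//.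
    slra.
  by apply/andP; split; nra.
rewrite -sqrtr_gt0.
have U01 x : I01 x -> `|0 - 2 * pi * ((1 - l)^-1 * l ^+ N) * x| <= 1 / 4.
  rewrite I01E => /andP[x0 x1]; rewrite sub0r normrN ger0_norm; last first.
    by rewrite !mulr_ge0// ?invr_ge0 ?exprn_ge0 ?ltW.
  have -> : 2 * pi * ((1 - l)^-1 * l ^+ N) = l ^+ N * K by rewrite /K; ring.
  have lN : 0 <= l ^+ N * K by rewrite mulr_ge0 ?exprn_ge0 ?ltW.
  nra.
have := sqrt_sqnorm_exp_dist bmu.1 (fun x => @cst_continuous R R 0 x) (@mulrl_continuous _ _) U01.
have -> : sqnorm_exp mu (fun=> 0) = 1.
  by rewrite /sqnorm_exp cos0 sin0 !Rintegral_cst//= probability_setT /= !mul0r !mul1r expr1n expr0n addr0.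
rewrite sqrtr1; rewrite -/(S _); lra.
Qed.

Lemma pisot_not_rajchman : pisot l^-1 -> ~ rajchman mu.
Proof.
move=> pis [cv _].
have l1 : 0 < 1 - l by slra.
have p0 := pi_gt0 R.
have [rho rho01 [K K0 near_int]] := pisot_near_int pis.
pose c j := cos (pi * l^-1 ^+ j.+1) ^+ 2.
have [d d0 cd] : exists2 d : R, 0 < d & forall k, d <= \prod_(j < k) c j.
  (* The factor 2 comes from the square: |cos| >= 1 - u gives cos^2 >= 1 - 2 u. *)
  apply: (@prod_bounded_below _ _ (2 * pi * K) rho) => //.
  - by rewrite !mulr_ge0// ltW.
  - move=> j; rewrite exprn_even_gt0//= pisot_cos_neq0//.
    by rewrite /= -subr_ge0 -sin2cos2 sqr_ge0.
  - move=> j; have [n nj] := near_int j.+1.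
    have := norm_cos_near_int (l^-1 ^+ j.+1) n.
    have : `|cos (pi * l^-1 ^+ j.+1)| <= 1 by exact: cos_max.
    rewrite /c -[X in _ -> _ -> _ <= X]real_normK ?num_real//.
    have : K * rho ^+ j.+1 <= K * rho ^+ j.
      rewrite exprS mulrCA ler_piMl ?mulr_ge0 ?exprn_ge0//; case/andP: rho01 => *; exact: ltW.
    move=> Kj; have := ler_wpM2l (ltW p0) (le_trans nj Kj).
    have := normr_ge0 (cos (pi * l^-1 ^+ j.+1)).
    nra.
pose xi k := l^-1 ^+ k / (1 - l).
have Sxi k : d * S (1 - l)^-1 <= S (xi k).
  rewrite (sqnorm_bernoulli (xi k) k) /xi.
  have -> : l^-1 ^+ k / (1 - l) * l ^+ k = (1 - l)^-1.
    by rewrite exprVn mulrAC mulVf ?mul1r// expf_neq0// lt0r_neq0.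
  rewrite ler_pM2r ?sqnorm_bernoulli_unit_gt0// (le_trans (cd k))//.
  (* At [xi k] the n-th factor is the square of cos (pi l^(-(k - n))); in reverse order the factors
     no longer depend on k. *)
  rewrite (reindex_inj rev_ord_inj)/= le_eqVlt; apply/orP; left; apply/eqP.
  apply: eq_bigr => j _; congr (cos (pi * _) ^+ 2).
  rewrite subnSK// divfK ?lt0r_neq0//.
  by rewrite expfB ?ltn_ord// !exprVn invrK.
have S0 : 0 < d * S (1 - l)^-1 by rewrite mulr_gt0// sqnorm_bernoulli_unit_gt0.
move: cv => /cvgr_lt/(_ (Num.sqrt (d * S (1 - l)^-1))); rewrite sqrtr_gt0.
move=> /(_ S0) [M [_ small]].
have [|k [kM _]] := geometric_threshold (q := l) (Num.max M 1); first by slra.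
have : M < xi k.
  have lk : 0 < l ^+ k by rewrite exprn_gt0.
  have : Num.max M 1 < l^-1 ^+ k by rewrite exprVn -[ltRHS]mul1r ltr_pdivlMr// mulrC.
  rewrite gt_max => /andP[Mk k1]; rewrite (lt_trans Mk)// /xi ltr_pdivlMr//.
  by rewrite gtr_pMr ?(lt_trans ltr01)//; slra.
move=> /small; rewrite normc_fourier_self ltNge.
by rewrite ler_wsqrtr ?Sxi.
Qed.
End pisot_not_rajchman.

Theorem theorem1p2 (R : realType) (lambda : R)
    (mu : probability (measurableTypeR R) R) :
  0 < lambda < 1 / 2 ->
  bernoulli_convolution lambda mu ->
  (forall (r : nat) (alpha : R), (1 <= r)%N -> 0 < alpha <= 1 ->
    let s := r%:R + alpha in
    let tau := decay_exponent s lambda in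
    exists g : {mfun measurableTypeR R >-> measurableTypeR R},
      [/\ diffeo01 r alpha g,
          self_conformal (distribution mu g),
          (exists2 eta : R, 0 < eta &
             forall x, topological_support mu x -> deriv01 g x = eta) &
          0 < tau /\
          exists2 C : R, 0 < C &
            forall xi : R, xi != 0 ->
              normc (fourier (distribution mu g) xi)
                <= C * `|xi| `^ (- tau)]) /\
  (pisot lambda^-1 -> ~ rajchman mu).
Proof.
move=> /andP[l0 l2] bmu; split; last exact: pisot_not_rajchman.
move=> r alpha r1 a01 s tau.
have [g [dg sg dg1 fg]] := smooth_image_with_decay l0 l2 bmu r1 a01.
exists g; split => //; split => //.
apply: decay_exponent_gt0 => //; rewrite (@le_trans _ _ r%:R)// ?ler1n// lerDl.
by case/andP: a01 => /ltW.
Qed.
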